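(* Let $N_0$ be a positive integer and let $\{M_N\}_{N\geq N_0}$ be positive integers with $\lim_{N\to\infty}M_N=\infty$. For each $N\geq N_0$, let $\mathbf{r}^{(N)}\in\mathbb{R}^{M_N}$ and $\mathbf{c}^{(N)}\in\mathbb{R}^N$ be positive vectors with $\Vert\mathbf{r}^{(N)}\Vert_1=\Vert\mathbf{c}^{(N)}\Vert_1$, let $\widetilde{A}^{(N)}\in\mathbb{R}^{M_N\times N}$ be a positive random matrix, let $A^{(N)}=\mathbb{E}[\widetilde{A}^{(N)}]$, and let $(\mathbf{x}^{(N)},\mathbf{y}^{(N)})$ be the unique pair of positive vectors with $\Vert\mathbf{x}^{(N)}\Vert_1=\Vert\mathbf{y}^{(N)}\Vert_1$ that scales $A^{(N)}$ to row sums $\mathbf{r}^{(N)}$ and column sums $\mathbf{c}^{(N)}$. Suppose that there are constants $0<a\leq b$, independent of $N$, such that for every $N\geq N_0$: $\widetilde{A}^{(N)}_{i,j}\in[a,b]$ almost surely for all $i\in[M_N]$, $j\in[N]$; the variables $\{\widetilde{A}^{(N)}_{i,j}\}_{j=1}^N$ are independent for each $i\in[M_N]$; and the variables $\{\widetilde{A}^{(N)}_{i,j}\}_{i=1}^{M_N}$ are independent for each $j\in[N]$. Suppose in addition that $\max_i r_i^{(N)}/\min_i r_i^{(N)}\leq C$ and $\max_j c_j^{(N)}/\min_j c_j^{(N)}\leq C$ for all indices $N$ and some universal constant $C$ (independent of $N$). Then there exists a sequence $\{(\widetilde{\mathbf{x}}^{(N)},\widetilde{\mathbf{y}}^{(N)})\}_{N\ge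 N_0}$ of pairs of positive random vectors, where $(\widetilde{\mathbf{x}}^{(N)},\widetilde{\mathbf{y}}^{(N)})$ scales $\widetilde{A}^{(N)}$ to row sums $\mathbf{r}^{(N)}$ and column sums $\mathbf{c}^{(N)}$, such that $$\mathcal{E}_N(\widetilde{\mathbf{x}}^{(N)},\widetilde{\mathbf{y}}^{(N)})=\mathcal{O}_{\text{w.h.p}}\left(\sqrt{\frac{\log(\max\{M_N,N\})}{\min\{M_N,N\}}}\right).$$
   Context: $[n]=\{1,\ldots,n\}$. A matrix or vector is positive if all its entries are strictly positive. A pair of vectors $(\mathbf{x},\mathbf{y})$ scales a matrix $B\in\mathbb{R}^{M\times N}$ to row sums $\mathbf{r}$ and column sums $\mathbf{c}$ if $\sum_{j=1}^N x_iB_{i,j}y_j=r_i$ for all $i\in[M]$ and $\sum_{i=1}^M x_iB_{i,j}y_j=c_j$ for all $j\in[N]$. For positive $B,\mathbf{r},\mathbf{c}$ with $\Vert\mathbf{r}\Vert_1=\Vert\mathbf{c}\Vert_1$ there is exactly one positive pair $(\mathbf{x},\mathbf{y})$ with $\Vert\mathbf{x}\Vert_1=\Vert\mathbf{y}\Vert_1$ scaling $B$ to row sums $\mathbf{r}$ and column sums $\mathbf{c}$. Error measure: for $\widetilde{\mathbf{x}}\in\mathbb{R}^{M_N}$, $\widetilde{\mathbf{y}}\in\mathbb{R}^N$, $$\mathcal{E}_N(\widetilde{\mathbf{x}},\widetilde{\mathbf{y}})=\max\left\{\max_{i\in[M_N]}\frac{\vert\widetilde{x}_i-x_i^{(N)}\vert}{x_i^{(N)}},\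 \max_{j\in[N]}\frac{\vert\widetilde{y}_j-y_j^{(N)}\vert}{y_j^{(N)}}\right\}.$$ For a sequence of random variables $X_N$ and a deterministic sequence $\gamma_N$, $X_N=\mathcal{O}_{\text{w.h.p}}(\gamma_N)$ means that there exists a constant $C'$ (independent of $N$) with $\lim_{N\to\infty}\Pr\{X_N\leq C'\gamma_N\}=1$. *)

(* Defs.v *)
From HB Require Import structures.
From mathcomp Require Export all_boot all_order all_algebra.
From mathcomp Require Export all_classical all_reals all_analysis.

Set Implicit Arguments.
Unset Strict Implicit.
Unset Printing Implicit Defensive.

Import Order.TTheory GRing.Theory Num.Theory.
Import numFieldNormedType.Exports.

Local Open Scope classical_set_scope.
Local Open Scope ring_scope.

Definition positive_mx (R : realType) (m n : nat) (B : 'M[R]_(m, n)) : Prop :=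
  forall i j, 0 < B i j.

Definition norm1 (R : realType) (n : nat) (v : 'rV[R]_n) : R :=
  \sum_(i < n) `|v 0 i|.

Definition scales (R : realType) (m n : nat) (x : 'rV[R]_m) (y : 'rV[R]_n)
    (B : 'M[R]_(m, n)) (r : 'rV[R]_m) (c : 'rV[R]_n) : Prop :=
  (forall i, \sum_(j < n) x 0 i * B i j * y 0 j = r 0 i) /\
  (forall j, \sum_(i < m) x 0 i * B i j * y 0 j = c 0 j).

(* The largest entry, for vectors with nonnegative entries: the default value 0
   is then neutral for the maximum. *)
Definition max_entry (R : realType) (n : nat) (v : 'rV[R]_n) : R :=
  \big[Num.max/0]_(i < n) v 0 i.

(* The smallest entry, for nonempty vectors with nonnegative entries: the
   default value [max_entry v] is an upper bound of the entries, so it never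
   affects the minimum. *)
Definition min_entry (R : realType) (n : nat) (v : 'rV[R]_n) : R :=
  \big[Num.min/max_entry v]_(i < n) v 0 i.

(* max_i |u_i - v_i| / v_i, meant for positive v. *)
Definition rel_error (R : realType) (n : nat) (u v : 'rV[R]_n) : R :=
  max_entry (\row_(i < n) (`|u 0 i - v 0 i| / v 0 i)).

Definition scaling_error (R : realType) (m n : nat)
    (x : 'rV[R]_m) (y : 'rV[R]_n) (x' : 'rV[R]_m) (y' : 'rV[R]_n) : R :=
  Num.max (rel_error x' x) (rel_error y' y).

(* Random matrices (and vectors, when m = 1) are functions on the sample space
   all of whose entries are real random variables. *)
Definition random_mx (d : measure_display) (T : measurableType d)
    (R : realType) (m n : nat) (B : T -> 'M[R]_(m, n)) : Prop :=
  forall i j, measurable_fun [set: T] (fun w => B w i j).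

(* Mutual independence of a finite family: the product rule holds over every
   subfamily and all Borel sets. *)
Definition mutually_independent (d : measure_display) (T : measurableType d)
    (R : realType) (P : probability T R) (I : finType) (X : I -> T -> R) : Prop :=
  forall (J : {set I}) (B : I -> set R),
    (forall i, i \in J -> measurable (B i)) ->
    P (\bigcap_(i in [set` J]) (X i @^-1` B i)) =
    (\prod_(i in J) P (X i @^-1` B i))%E.

(* X_N = O_whp(gamma_N); only the law of each X_N matters, so the X_N may live
   on different probability spaces. *)
Definition bigO_whp (R : realType) (d : nat -> measure_display)
    (T : forall N, measurableType (d N)) (P : forall N, probability (T N) R)
    (X : forall N, T N -> R) (gamma : nat -> R) : Prop :=
  exists C' : R,
    (fun N => P N [set w | X N w <= C' * gamma N]) @ \oo --> (1 : \bar R)%E.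

(* Main.v *)
From HB Require Import structures.
Require Import Defs.
From mathcomp Require Import all_boot all_order all_algebra.
From mathcomp Require Import all_classical all_reals all_analysis.
From mathcomp Require Import measurable_realfun.
From mathcomp Require Import ring lra zify.

(* The scaling vectors of the random matrix are obtained as the limit of the
   Sinkhorn iteration started at the deterministic vector y that scales the
   mean matrix A.  Measured by max_i (v_i / u_i) / min_i (v_i / u_i) - 1, the
   distance between consecutive iterates contracts by a factor 1 - theta that
   only depends on the cross ratios of the matrix (Birkhoff-Hopf), hence only
   on a and b; conservation of the total mass turns this projective estimate
   into an entrywise one.  So the iteration converges (which gives existence
   and measurability at once, for every positive matrix), and its limit stays
   within a relative distance of order eta of y as soon as the row sums
   sum_j A_ij y_j and the column sums sum_i x_i A_ij change by a relative amount
   at most eta when A is replaced by the random matrix.  By Hoeffding's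
   inequality and a union bound over the rows and columns, this holds with
   eta = O(sqrt (ln (max M N) / min M N)) outside an event of probability
   O(1 / N); the weights y_j have comparable sizes because the c_j do. *)

Set Implicit Arguments.
Unset Strict Implicit.
Unset Printing Implicit Defensive.

Import Order.TTheory GRing.Theory Num.Theory.
Import numFieldNormedType.Exports.

Local Open Scope classical_set_scope.
Local Open Scope ring_scope.

(** * Contraction of the scaling maps *)

Section Contraction.
Variable R : realType.

(** The half-step of Sinkhorn's iteration. Vectors are stored as rows, so [y *m B^T] is the product
    of B and y; for positive data, dividing r by it gives the only x that meets the row sums. The
    column update is the same map for [B^T]. *)
Definition row_fit (m n : nat) (B : 'M[R]_(m, n)) (r : 'rV[R]_m)
  (y : 'rV[R]_n) : 'rV[R]_m := \row_i (r 0 i / (y *m B^T) 0 i).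

(** For positive vectors this bounds Thompson's distance max_i |ln u_i - ln v_i| by ln lam. *)
Definition within_factor (n : nat) (lam : R) (u v : 'rV[R]_n) : Prop :=
  forall i, u 0 i <= lam * v 0 i /\ v 0 i <= lam * u 0 i.

(* max_i (v_i / u_i) <= (1 + rho) min_i (v_i / u_i): the exponential of
   Hilbert's projective distance is at most 1 + rho. *)
Definition osc (n : nat) (rho : R) (u v : 'rV[R]_n) : Prop :=
  forall i k, v 0 i * u 0 k <= (1 + rho) * (u 0 i * v 0 k).

(** A lower bound on all cross ratios, stated without division; a larger theta gives a stronger
    contraction. *)
Definition cross_ratio (m n : nat) (theta : R) (B : 'M[R]_(m, n)) : Prop :=
  forall i i' j j', theta * (B i j' * B i' j) <= B i j * B i' j'.

Lemma mul_trE (m n : nat) (B : 'M[R]_(m, n)) (y : 'rV[R]_n) i :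
  (y *m B^T) 0 i = \sum_j B i j * y 0 j.
Proof. by rewrite mxE; apply: eq_bigr => j _; rewrite mxE mulrC. Qed.

Lemma positive_tr (m n : nat) (B : 'M[R]_(m, n)) :
  positive_mx B -> positive_mx B^T.
Proof. by move=> B0 i j; rewrite mxE. Qed.

Lemma cross_ratio_tr (m n : nat) theta (B : 'M[R]_(m, n)) :
  cross_ratio theta B -> cross_ratio theta B^T.
Proof.
move=> Bt i i' j j'; rewrite !mxE; have := Bt j j' i i'.
by rewrite [B j' i * _]mulrC.
Qed.

Lemma sumr_pos (n : nat) (F : 'I_n -> R) :
  (0 < n)%N -> (forall i, 0 < F i) -> 0 < \sum_i F i.
Proof.
case: n F => // n F _ F0; rewrite big_ord_recl ltr_pwDl//.
by apply: sumr_ge0 => i _; exact/ltW.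
Qed.

Lemma positive_mul_tr (m n : nat) (B : 'M[R]_(m, n)) (y : 'rV[R]_n) :
  (0 < n)%N -> positive_mx B -> positive_mx y -> positive_mx (y *m B^T).
Proof.
move=> n0 B0 y0 i j; rewrite ord1 mul_trE; apply: sumr_pos => // k.
exact: mulr_gt0.
Qed.

Lemma positive_row_fit (m n : nat) (B : 'M[R]_(m, n)) r y :
  (0 < n)%N -> positive_mx B -> positive_mx r -> positive_mx y ->
  positive_mx (row_fit B r y).
Proof.
move=> n0 B0 r0 y0 i j; rewrite mxE; apply: divr_gt0 => //.
exact: positive_mul_tr.
Qed.

Lemma within_factor_trans (n : nat) lam mu (u v w : 'rV[R]_n) : 0 <= lam -> 0 <= mu ->
  within_factor lam u v -> within_factor mu v w -> within_factor (lam * mu) u w.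
Proof.
move=> l0 m0 uv vw i; have [uv1 uv2] := uv i; have [vw1 vw2] := vw i; split.
  by rewrite (le_trans uv1)// -mulrA ler_wpM2l.
by rewrite (le_trans vw2)// (mulrC lam) -mulrA ler_wpM2l.
Qed.

Lemma within_factor_mul_tr (m n : nat) lam (B : 'M[R]_(m, n)) y y' :
  positive_mx B -> within_factor lam y y' -> within_factor lam (y *m B^T) (y' *m B^T).
Proof.
move=> B0 yy i; rewrite !mul_trE; split; rewrite mulr_sumr;
apply: ler_sum => j _; rewrite mulrCA ler_wpM2l ?(ltW (B0 _ _))//;
by have [] := yy j.
Qed.

Lemma within_factor_div (n : nat) lam (r s s' : 'rV[R]_n) :
  positive_mx r -> positive_mx s -> positive_mx s' -> within_factor lam s s' ->
  within_factor lam (\row_i (r 0 i / s 0 i)) (\row_i (r 0 i / s' 0 i)).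
Proof.
move=> r0 s0 s'0 ss i; rewrite !mxE !(mulrCA lam) !ler_pM2l//.
rewrite !ler_pdivlMr// !ler_pdivrMl// ![_ * lam]mulrC.
by have [] := ss i.
Qed.

Lemma within_factor_row_fit (m n : nat) lam (B : 'M[R]_(m, n)) r y y' :
  (0 < n)%N -> positive_mx B -> positive_mx r -> positive_mx y ->
  positive_mx y' -> within_factor lam y y' ->
  within_factor lam (row_fit B r y) (row_fit B r y').
Proof.
move=> n0 B0 r0 y0 y'0 yy.
by apply: within_factor_div; [|exact: positive_mul_tr..|exact: within_factor_mul_tr].
Qed.

(** The ratios v_i / u_i lie in [1 / lam, lam], so the quotient of any two of them is at most lam ^
    2. *)
Lemma osc_of_within_factor (n : nat) lam (u v : 'rV[R]_n) : 1 <= lam ->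
  positive_mx u -> positive_mx v -> within_factor lam u v ->
  osc (lam ^+ 2 - 1) u v.
Proof.
move=> l1 u0 v0 uv i k; rewrite addrC subrK.
have [_ h1] := uv i; have [h2 _] := uv k.
rewrite [leRHS](_ : _ * _ = lam * u 0 i * (lam * v 0 k)); last by ring.
by apply: ler_pM => //; exact/ltW.
Qed.

(* If the total masses W.u and W.v agree, 1 lies between the extreme ratios
   v_i / u_i. *)
Lemma within_factor_of_osc (n : nat) rho (W u v : 'rV[R]_n) : (0 < n)%N ->
  positive_mx W -> positive_mx u -> positive_mx v ->
  \sum_j W 0 j * u 0 j = \sum_j W 0 j * v 0 j ->
  osc rho u v -> within_factor (1 + rho) u v.
Proof.
move=> n0 W0 u0 v0 WW uv i.
have S0 : 0 < \sum_j W 0 j * u 0 j.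
  by apply: sumr_pos => // j; exact: mulr_gt0.
split.
- rewrite -(ler_pM2r S0) {1}WW !mulr_sumr; apply: ler_sum => j _.
  have h := uv j i; rewrite -(ler_pM2l (W0 0 j)) in h; move: h.
  by congr (_ <= _); ring.
- rewrite -(ler_pM2r S0) {2}WW !mulr_sumr; apply: ler_sum => j _.
  have h := uv i j; rewrite -(ler_pM2l (W0 0 j)) in h; move: h.
  by congr (_ <= _); ring.
Qed.

(* The i-th quotient (B y')_i / (B y)_i is an average of the ratios y'_j / y_j
   with weights proportional to B_ij y_j, and by the cross-ratio bound the
   weights of one row are at least theta times those of any other row. *)
Lemma osc_row_fit (m n : nat) theta rho (B : 'M[R]_(m, n)) r y y' :
  (0 < n)%N -> theta <= 1 -> 0 <= rho ->
  positive_mx B -> positive_mx r -> positive_mx y -> positive_mx y' ->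
  cross_ratio theta B -> osc rho y y' ->
  osc ((1 - theta) * rho) (row_fit B r y) (row_fit B r y').
Proof.
move=> n0 th1 rho0 B0 r0 y0 y'0 Bt yy i k; rewrite ![row_fit _ _ _ _ _]mxE.
have s0 := positive_mul_tr n0 B0 y0; have s'0 := positive_mul_tr n0 B0 y'0.
set S := (y *m B^T) 0 i; set S' := (y *m B^T) 0 k.
set U := (y' *m B^T) 0 i; set V := (y' *m B^T) 0 k.
have [S0 S'0 U0 V0] : [/\ 0 < S, 0 < S', 0 < U & 0 < V].
  by split; [exact: s0|exact: s0|exact: s'0|exact: s'0].
(* Division inverts the ratios, so the claim for the fits at (i, k) is the claim for the products at
   (k, i). *)
suff key : V * S <= (1 + (1 - theta) * rho) * (U * S').
  rewrite [leLHS](_ : _ = r 0 i * r 0 k / (U * S' * V * S) * (V * S)); last first.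
    by field; rewrite !gt_eqF.
  rewrite [leRHS](_ : _ = r 0 i * r 0 k / (U * S' * V * S) *
      ((1 + (1 - theta) * rho) * (U * S'))); last first.
    by field; rewrite !gt_eqF.
  by apply: ler_wpM2l => //; rewrite divr_ge0// ?mulr_ge0// ltW// !mulr_gt0.
(* [l] is the least ratio y'_j / y_j; the excess y' - l y is then nonnegative and at most rho l
   y. *)
pose j0 := [arg min_(j < Ordinal n0) (y' 0 j / y 0 j)]%O.
pose l := y' 0 j0 / y 0 j0.
have l0 : 0 < l by exact: divr_gt0.
have lmin j : l * y 0 j <= y' 0 j.
  by rewrite -ler_pdivlMr// /l /j0; case: arg_minP => // j1 _; exact.
have lmax j : y' 0 j <= (1 + rho) * (l * y 0 j).
  rewrite /l -(ler_pM2r (y0 0 j0)) mulrAC.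
  rewrite [leRHS](_ : _ = (1 + rho) * (y 0 j * y' 0 j0)); last first.
    by field; rewrite gt_eqF.
  by have := yy j j0; rewrite mulrC [in leRHS]mulrC; congr (_ <= _); ring.
have SE : S = \sum_j B i j * y 0 j by rewrite /S mul_trE.
have S'E : S' = \sum_j B k j * y 0 j by rewrite /S' mul_trE.
have UE : U - l * S = \sum_j B i j * (y' 0 j - l * y 0 j).
  rewrite /U SE mul_trE mulr_sumr -sumrB; apply: eq_bigr => j _; ring.
have VE : V - l * S' = \sum_j B k j * (y' 0 j - l * y 0 j).
  rewrite /V S'E mul_trE mulr_sumr -sumrB; apply: eq_bigr => j _; ring.
have lS : l * S <= U.
  rewrite -subr_ge0 UE; apply: sumr_ge0 => j _.
  by rewrite mulr_ge0 ?subr_ge0// ltW.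
(* Domination of the normalized weights, B_ij y_j / S >= theta B_kj y_j / S', with the common y_j
   cancelled and the denominators cleared. *)
have dom j : theta * (B k j * S) <= B i j * S'.
  rewrite SE S'E !mulr_sumr; apply: ler_sum => q _.
  rewrite !mulrA ler_wpM2r ?(ltW (y0 _ _))//.
  by have := Bt i k j q; congr (_ <= _); ring.
have UV : theta * ((V - l * S') * S) <= (U - l * S) * S'.
  rewrite UE VE !mulr_suml mulr_sumr; apply: ler_sum => j _.
  rewrite (_ : theta * _ = theta * (B k j * S) * (y' 0 j - l * y 0 j)); last by ring.
  rewrite [leRHS](_ : _ = B i j * S' * (y' 0 j - l * y 0 j)); last by ring.
  by apply: ler_wpM2r => //; rewrite subr_ge0.
have VS : V - l * S' <= rho * (l * S').
  suff : V <= (1 + rho) * (l * S') by rewrite mulrDl mul1r lerBlDl.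
  rewrite /V S'E mul_trE !mulr_sumr; apply: ler_sum => j _.
  rewrite (_ : _ * (l * _) = B k j * ((1 + rho) * (l * y 0 j))); last by ring.
  by rewrite ler_wpM2l// ltW.
have th0 : 0 <= 1 - theta by rewrite subr_ge0.
(* (V - l S') S is split into its shares theta and 1 - theta: [UV] bounds the first by (U - l S) S',
   [VS] bounds the second by (1 - theta) rho l S S', and l S <= U concludes. *)
have h1 : (1 - theta) * ((V - l * S') * S) <= (1 - theta) * (rho * (l * S') * S).
  by rewrite ler_wpM2l// ler_wpM2r// ltW.
have h2 : (1 - theta) * rho * (l * S * S') <= (1 - theta) * rho * (U * S').
  by rewrite ler_wpM2l ?mulr_ge0// ler_wpM2r// ltW.
lra.
Qed.

End Contraction.

(** * The Sinkhorn iteration *)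

Section SinkhornIteration.
Variable R : realType.

(** The telescoping series is dominated by a geometric one, whose sum K / (1 - q) bounds every
    displacement from the start and hence that of the limit. *)
Lemma geometric_increments_cvg (u : R^nat) (K q : R) :
  0 <= K -> 0 <= q < 1 -> (forall k, `|u k.+1 - u k| <= K * q ^+ k) ->
  exists2 l, u @ \oo --> l & `|l - u 0%N| <= K / (1 - q).
Proof.
move=> K0 /andP[q0 q1] uq.
have nq1 : `|q| < 1 by rewrite ger0_norm.
have bnd n : `|u n - u 0%N| <= K / (1 - q).
  have -> : u n - u 0%N = series (telescope u) n by rewrite telescopeK.
  apply: (le_trans (ler_norm_sum _ _ _)).
  apply: (@le_trans _ _ (series (geometric K q) n)).
    by apply: ler_sum => k _; exact: uq.
  rewrite geometric_seriesE ?lt_eqF// ler_pdivrMr ?subr_gt0//.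
  rewrite mulfVK ?subr_eq0 ?gt_eqF//.
  by rewrite ler_piMr// gerBl exprn_ge0.
have cs : cvgn (series (telescope u)).
  apply: normed_cvg; apply: series_le_cvg (is_cvg_geometric_series (a := K) nq1).
  - by move=> k /=.
  - by move=> k; exact: geometric_ge0.
  - by move=> k; exact: uq.
have cu : u @ \oo --> u 0%N + limn (series (telescope u)).
  rewrite [X in X @ _](_ : u = (fun n => u 0%N + series (telescope u) n)); last first.
    by apply/funext => n; exact: eq_sum_telescope.
  by apply: cvgD; [exact: cvg_cst|exact: cs].
exists (u 0%N + limn (series (telescope u))) => //.
have : `|u n - u 0%N| @[n --> \oo] --> `|u 0%N + limn (series (telescope u)) - u 0%N|.
  by apply: cvg_norm; apply: cvgB; [exact: cu|exact: cvg_cst].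
by move/cvgr_to_le; apply; exact: nearW.
Qed.

Definition sinkhorn_step (m n : nat) (B : 'M[R]_(m, n)) r c y :=
  row_fit B^T c (row_fit B r y).

Definition sinkhorn (m n : nat) (B : 'M[R]_(m, n)) r c y k :=
  iter k (sinkhorn_step B r c) y.

(** Only the column vector is iterated; the row vector is recovered from this limit by one
    [row_fit]. The limit is a genuine one for positive data with matching masses, by
    [sinkhorn_lim_correct]. *)
Definition sinkhorn_lim (m n : nat) (B : 'M[R]_(m, n)) r c y : 'rV[R]_n :=
  \row_j limn (fun k => sinkhorn B r c y k 0 j).

Lemma positive_sinkhorn (m n : nat) (B : 'M[R]_(m, n)) r c y k :
  (0 < m)%N -> (0 < n)%N -> positive_mx B -> positive_mx r ->
  positive_mx c -> positive_mx y -> positive_mx (sinkhorn B r c y k).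
Proof.
move=> m0 n0 B0 r0 c0 y0; elim: k => //= k IHk.
by apply: positive_row_fit => //; [exact: positive_tr|exact: positive_row_fit].
Qed.

Lemma osc_le (n : nat) rho rho' (u v : 'rV[R]_n) :
  positive_mx u -> positive_mx v -> rho <= rho' -> osc rho u v -> osc rho' u v.
Proof.
move=> u0 v0 rr uv i k; apply: le_trans (uv i k) _.
by rewrite ler_wpM2r ?lerD2l// ltW// mulr_gt0.
Qed.

Lemma osc_sinkhorn (m n : nat) (B : 'M[R]_(m, n)) r c y theta rho k :
  (0 < m)%N -> (0 < n)%N -> positive_mx B -> positive_mx r ->
  positive_mx c -> positive_mx y -> 0 < theta <= 1 -> 0 <= rho ->
  cross_ratio theta B -> osc rho y (sinkhorn_step B r c y) ->
  osc (rho * (1 - theta) ^+ k) (sinkhorn B r c y k) (sinkhorn B r c y k.+1).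
Proof.
move=> m0 n0 B0 r0 c0 y0 /andP[th0 th1] rho0 Bt h0.
have pos i : positive_mx (sinkhorn B r c y i) by exact: positive_sinkhorn.
have th01 : 0 <= 1 - theta by rewrite subr_ge0.
elim: k => [|k IHk]; first by rewrite expr0 mulr1.
have hk : 0 <= rho * (1 - theta) ^+ k by rewrite mulr_ge0 ?exprn_ge0.
(* A full step consists of a row fit and a column fit, so it contracts by (1 - theta) ^ 2; one of
   the two factors is given away. *)
apply: (@osc_le _ ((1 - theta) * ((1 - theta) * (rho * (1 - theta) ^+ k)))) => //.
  rewrite exprS [leRHS]mulrCA ler_piMl ?mulr_ge0//.
    by rewrite exprn_ge0.
  by rewrite gerBl ltW.
have posr i : positive_mx (row_fit B r (sinkhorn B r c y i)).
  exact: positive_row_fit.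
apply: osc_row_fit => //; first exact: mulr_ge0.
- exact: positive_tr.
- exact: (posr k.+1).
- exact: cross_ratio_tr.
- exact: (osc_row_fit n0 th1 hk B0 r0 (pos k) (pos k.+1) Bt IHk).
Qed.

(** Conservation of mass: for x the row fit of y, the weights W = x B give y the total mass sum r
    and the next iterate the total mass sum c. As these agree, [within_factor_of_osc] applies. *)
Lemma within_factor_sinkhorn_step (m n : nat) (B : 'M[R]_(m, n)) r c y rho :
  (0 < m)%N -> (0 < n)%N -> positive_mx B -> positive_mx r ->
  positive_mx c -> positive_mx y -> \sum_i r 0 i = \sum_j c 0 j ->
  osc rho y (sinkhorn_step B r c y) -> within_factor (1 + rho) y (sinkhorn_step B r c y).
Proof.
move=> m0 n0 B0 r0 c0 y0 rc.
have x0 : positive_mx (row_fit B r y) by exact: positive_row_fit.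
have W0 : positive_mx (row_fit B r y *m B^T^T).
  by apply: positive_mul_tr => //; exact: positive_tr.
apply: (within_factor_of_osc n0 W0) => //.
  by apply: positive_row_fit => //; exact: positive_tr.
transitivity (\sum_i r 0 i); last first.
  rewrite rc; apply: eq_bigr => j _; rewrite [sinkhorn_step _ _ _ _ _ _]mxE mulrC divfK//.
  by rewrite gt_eqF.
have s0 := positive_mul_tr n0 B0 y0.
under eq_bigr do rewrite mul_trE mulr_suml.
rewrite exchange_big; apply: eq_bigr => i _ /=.
transitivity (row_fit B r y 0 i * (y *m B^T) 0 i).
  by rewrite mul_trE mulr_sumr; apply: eq_bigr => j _; rewrite mxE; ring.
by rewrite mxE divfK// gt_eqF.
Qed.

Lemma row_fit_cvg (m n : nat) (B : 'M[R]_(m, n)) r (y_ : nat -> 'rV[R]_n) y i :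
  (0 < n)%N -> positive_mx B -> positive_mx y ->
  (forall j, y_ k 0 j @[k --> \oo] --> y 0 j) ->
  row_fit B r (y_ k) 0 i @[k --> \oo] --> row_fit B r y 0 i.
Proof.
move=> n0 B0 y0 yy.
rewrite [X in X @ _](_ : _ = fun k => r 0 i / \sum_j B i j * y_ k 0 j); last first.
  by apply/funext => k; rewrite mxE mul_trE.
rewrite mxE; apply: cvgM; first exact: cvg_cst.
apply: cvgV; first by rewrite gt_eqF// positive_mul_tr.
rewrite mul_trE; apply: cvg_big => [|j _]; first exact: add_continuous.
by apply: cvgM => //; exact: cvg_cst.
Qed.


(** Since ln (1 + rho) <= rho, multiplicative closeness becomes an additive bound on logarithms, to
    which [geometric_increments_cvg] applies. *)
Lemma ln_within_factor (n : nat) rho (u v : 'rV[R]_n) j : 0 <= rho ->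
  positive_mx u -> positive_mx v -> within_factor (1 + rho) u v ->
  `|ln (v 0 j) - ln (u 0 j)| <= rho.
Proof.
move=> rho0 u0 v0 uv; have [uv1 uv2] := uv j.
have r1 : 0 < 1 + rho by rewrite ltr_pwDl.
have lr : ln (1 + rho) <= rho by apply: le_ln1Dx; rewrite (lt_le_trans _ rho0).
have aux (p q : R) : 0 < p -> 0 < q -> p <= (1 + rho) * q -> ln p - ln q <= rho.
  move=> p0 q0 pq; apply: le_trans lr; rewrite lerBlDr -lnM ?posrE//.
  by rewrite ler_ln ?posrE// mulr_gt0.
by rewrite ler_norml lerNl opprB !aux.
Qed.

(** The logarithm of each entry moves by at most rho (1 - theta) ^ k at step k, so by at most rho /
    theta in all. Writing the limit as an exponential makes it positive. *)
Lemma sinkhorn_cvg (m n : nat) (B : 'M[R]_(m, n)) r c y theta rho :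
  (0 < m)%N -> (0 < n)%N -> positive_mx B -> positive_mx r ->
  positive_mx c -> positive_mx y -> \sum_i r 0 i = \sum_j c 0 j ->
  0 < theta <= 1 -> 0 <= rho -> cross_ratio theta B ->
  osc rho y (sinkhorn_step B r c y) ->
  [/\ forall j, sinkhorn B r c y k 0 j @[k --> \oo] --> sinkhorn_lim B r c y 0 j,
      positive_mx (sinkhorn_lim B r c y) &
      within_factor (expR (rho / theta)) y (sinkhorn_lim B r c y)].
Proof.
move=> m0 n0 B0 r0 c0 y0 rc /andP[th0 th1] rho0 Bt h0.
have pos k : positive_mx (sinkhorn B r c y k) by exact: positive_sinkhorn.
have th01 : 0 <= 1 - theta < 1 by rewrite subr_ge0 th1 gtrBl.
have key j : exists2 l, sinkhorn B r c y k 0 j @[k --> \oo] --> expR l &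
    `|l - ln (y 0 j)| <= rho / theta.
  have [k|l ul lu] := @geometric_increments_cvg
      (fun k => ln (sinkhorn B r c y k 0 j)) rho (1 - theta) rho0 th01.
    have hk : 0 <= rho * (1 - theta) ^+ k.
      by rewrite mulr_ge0 ?exprn_ge0//; have /andP[] := th01.
    apply: ln_within_factor => //; apply: within_factor_sinkhorn_step => //.
    by apply: osc_sinkhorn => //; rewrite th0.
  exists l; last by rewrite subKr in lu.
  rewrite (_ : (fun k => _) = expR \o (fun k => ln (sinkhorn B r c y k 0 j))).
    by apply: continuous_cvg => //; exact: continuous_expR.
  by apply/funext => k /=; rewrite lnK ?posrE//; exact: pos.
have lim j : exists2 l, sinkhorn_lim B r c y 0 j = expR l &
    `|l - ln (y 0 j)| <= rho / theta.
  have [l ul lu] := key j; exists l => //.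
  by rewrite mxE; apply/cvg_lim.
split.
- by move=> j; rewrite mxE; have [l ul _] := key j; apply/cvg_ex; exists (expR l).
- by move=> i j; rewrite ord1; have [l -> _] := lim j; exact: expR_gt0.
- move=> j; have [l -> ] := lim j; rewrite ler_norml lerBlDr lerNl opprB lerBlDr.
  move=> /andP[l1 l2].
  rewrite -[y 0 j]lnK ?posrE//.
  by rewrite -!expRD !ler_expR.
Qed.

(** By continuity the limit is a fixed point of the step. The row sums are exact because x is a row
    fit of the limit, the column sums because the fixed-point equation makes the limit a column fit
    of x. *)
Lemma sinkhorn_lim_scales (m n : nat) (B : 'M[R]_(m, n)) r c y theta rho :
  (0 < m)%N -> (0 < n)%N -> positive_mx B -> positive_mx r ->
  positive_mx c -> positive_mx y -> \sum_i r 0 i = \sum_j c 0 j ->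
  0 < theta <= 1 -> 0 <= rho -> cross_ratio theta B ->
  osc rho y (sinkhorn_step B r c y) ->
  scales (row_fit B r (sinkhorn_lim B r c y)) (sinkhorn_lim B r c y) B r c.
Proof.
move=> m0 n0 B0 r0 c0 y0 rc th rho0 Bt h0.
have [ys lim0 _] := sinkhorn_cvg m0 n0 B0 r0 c0 y0 rc th rho0 Bt h0.
set z := sinkhorn_lim B r c y in ys lim0 *.
have x0 : positive_mx (row_fit B r z) by exact: positive_row_fit.
have zE : z = row_fit B^T c (row_fit B r z).
  apply/rowP => j.
  have h : sinkhorn B r c y k.+1 0 j @[k --> \oo] --> row_fit B^T c (row_fit B r z) 0 j.
    apply: row_fit_cvg => //; first exact: positive_tr.
    by move=> i; exact: row_fit_cvg.
  have h' : sinkhorn B r c y k.+1 0 j @[k --> \oo] --> z 0 j.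
    by move: (ys j); rewrite -(cvg_shiftS (fun k => sinkhorn B r c y k 0 j)).
  by rewrite -(cvg_lim _ h) // -(cvg_lim _ h').
split=> [i|j].
  under eq_bigr do rewrite -mulrA.
  rewrite -mulr_sumr -mul_trE mxE divfK// gt_eqF//.
  exact: positive_mul_tr.
rewrite -mulr_suml; under eq_bigr do rewrite mulrC.
transitivity ((row_fit B r z *m B^T^T) 0 j * z 0 j).
  by rewrite mul_trE; congr (_ * _); apply: eq_bigr => i _; rewrite [B^T _ _]mxE.
rewrite {2}zE [row_fit B^T _ _ _ _]mxE mulrC divfK// gt_eqF//.
by apply: positive_mul_tr => //; exact: positive_tr.
Qed.

End SinkhornIteration.

(** * Stability *)

Section Stability.
Variable R : realType.

Lemma finite_ub (I : finType) (F : I -> R) :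
  exists2 M, 0 <= M & forall i, F i <= M.
Proof.
exists (\sum_i `|F i|) => [|i]; first exact: sumr_ge0.
by rewrite (bigD1 i)//= (le_trans (ler_norm _))// lerDl sumr_ge0.
Qed.

(** There are finitely many inverse cross ratios, with a common bound M; using 1 + M in place of M
    keeps theta well defined and at most 1. *)
Lemma exists_cross_ratio (m n : nat) (B : 'M[R]_(m, n)) : positive_mx B ->
  exists2 theta, 0 < theta <= 1 & cross_ratio theta B.
Proof.
move=> B0; have [M M0 BM] := finite_ub (fun p : 'I_m * 'I_m * 'I_n * 'I_n =>
  B p.1.1.1 p.2 * B p.1.1.2 p.1.2 / (B p.1.1.1 p.1.2 * B p.1.1.2 p.2)).
have M1 : 0 < 1 + M by rewrite ltr_pwDl.
exists (1 + M)^-1; first by rewrite invr_gt0 M1 invf_le1// lerDl.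
move=> i i' j j'; have /= := BM (i, i', j, j').
rewrite ler_pdivrMr ?mulr_gt0// ler_pdivrMl// => /le_trans; apply.
by rewrite ler_pM2r ?mulr_gt0// lerDr.
Qed.

Lemma exists_osc (n : nat) (u v : 'rV[R]_n) : positive_mx u -> positive_mx v ->
  exists2 rho, 0 <= rho & osc rho u v.
Proof.
move=> u0 v0; have [M M0 uvM] := finite_ub (fun p : 'I_n * 'I_n =>
  v 0 p.1 * u 0 p.2 / (u 0 p.1 * v 0 p.2)).
exists M => // i k; have /= := uvM (i, k).
rewrite ler_pdivrMr ?mulr_gt0// => /le_trans; apply.
by rewrite ler_pM2r ?mulr_gt0// lerDr.
Qed.

(** Here theta and rho may depend on the matrix and on y. This covers every outcome of the random
    matrix, including the null set where entries leave [a, b]. *)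
Lemma sinkhorn_lim_correct (m n : nat) (B : 'M[R]_(m, n)) r c y :
  (0 < m)%N -> (0 < n)%N -> positive_mx B -> positive_mx r ->
  positive_mx c -> positive_mx y -> \sum_i r 0 i = \sum_j c 0 j ->
  [/\ forall j, sinkhorn B r c y k 0 j @[k --> \oo] --> sinkhorn_lim B r c y 0 j,
      positive_mx (sinkhorn_lim B r c y) &
      scales (row_fit B r (sinkhorn_lim B r c y)) (sinkhorn_lim B r c y) B r c].
Proof.
move=> m0 n0 B0 r0 c0 y0 rc.
have [theta th Bt] := exists_cross_ratio B0.
have [rho rho0 h] := exists_osc y0 (positive_sinkhorn 1 m0 n0 B0 r0 c0 y0).
have [] := sinkhorn_cvg m0 n0 B0 r0 c0 y0 rc th rho0 Bt h.
move=> ys pos _; split => //.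
exact: (sinkhorn_lim_scales m0 n0 B0 r0 c0 y0 rc th rho0 Bt h).
Qed.

Definition entries_in (m n : nat) (a b : R) (B : 'M[R]_(m, n)) : Prop :=
  forall i j, a <= B i j <= b.

Lemma entries_in_tr (m n : nat) (a b : R) (B : 'M[R]_(m, n)) :
  entries_in a b B -> entries_in a b B^T.
Proof. by move=> Bab i j; rewrite mxE. Qed.

Lemma entries_in_positive (m n : nat) (a b : R) (B : 'M[R]_(m, n)) :
  0 < a -> entries_in a b B -> positive_mx B.
Proof. by move=> a0 Bab i j; have /andP[/(lt_le_trans a0)] := Bab i j. Qed.

(** Products of two entries lie between a ^ 2 and b ^ 2. This is the contraction constant that is
    uniform in the dimensions. *)
Lemma cross_ratio_entries_in (m n : nat) (a b : R) (B : 'M[R]_(m, n)) :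
  0 < a -> a <= b -> entries_in a b B -> cross_ratio ((a / b) ^+ 2) B.
Proof.
move=> a0 ab Bab i i' j j'; have b0 := lt_le_trans a0 ab.
have B0 := entries_in_positive a0 Bab.
apply: (@le_trans _ _ (a * a)).
  rewrite expr_div_n mulrAC ler_pdivrMr ?exprn_gt0// expr2.
  rewrite ler_pM2l ?mulr_gt0// expr2; apply: ler_pM; rewrite ?(ltW (B0 _ _))//.
    by have /andP[] := Bab i j'.
  by have /andP[] := Bab i' j.
apply: ler_pM; rewrite ?(ltW a0)//.
  by have /andP[] := Bab i j.
by have /andP[] := Bab i' j'.
Qed.

Lemma mul_tr_le (m n : nat) (a b : R) (B B' : 'M[R]_(m, n))
    (y : 'rV[R]_n) i :
  0 < a -> a <= b -> positive_mx y ->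
  entries_in a b B -> entries_in a b B' ->
  (y *m B^T) 0 i <= b / a * (y *m B'^T) 0 i.
Proof.
move=> a0 ab y0 Bab B'ab; rewrite !mul_trE mulr_sumr; apply: ler_sum => j _.
rewrite mulrA ler_wpM2r ?(ltW (y0 _ _))//; have /andP[_ Bb] := Bab i j.
apply: le_trans Bb _; rewrite mulrAC ler_pdivlMr// ler_wpM2l//.
  by rewrite (le_trans (ltW a0)).
by have /andP[] := B'ab i j.
Qed.

Lemma mul_trB (m n : nat) (B B' : 'M[R]_(m, n)) (y : 'rV[R]_n) i :
  (y *m (B' - B)^T) 0 i = (y *m B'^T) 0 i - (y *m B^T) 0 i.
Proof.
by rewrite !mul_trE -sumrB; apply: eq_bigr => j _; rewrite !mxE mulrBl.
Qed.

(** The difference of two nonnegative numbers, each at most b / a times the product for B. It caps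
    the deviation level in [sinkhorn_stable]. *)
Lemma deviation_trivial (m n : nat) (a b : R) (B B' : 'M[R]_(m, n))
    (y : 'rV[R]_n) i :
  0 < a -> a <= b -> positive_mx y ->
  entries_in a b B -> entries_in a b B' ->
  `|(y *m (B' - B)^T) 0 i| <= b / a * (y *m B^T) 0 i.
Proof.
move=> a0 ab y0 Bab B'ab; rewrite mul_trB.
have h1 := mul_tr_le i a0 ab y0 B'ab Bab.
have k1 : 1 <= b / a by rewrite ler_pdivlMr// mul1r.
have pos (D : 'M[R]_(m, n)) : entries_in a b D -> 0 <= (y *m D^T) 0 i.
  move=> Dab; rewrite mul_trE sumr_ge0// => j _.
  by rewrite mulr_ge0 ?ltW//; exact: entries_in_positive Dab _ _.
rewrite ler_norml lerBlDr lerBrDl -lerBrDr opprK; apply/andP; split.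
  rewrite (le_trans (ler_peMl (pos _ Bab) k1))// lerDr; exact: pos.
by rewrite (le_trans h1)// lerDl pos.
Qed.

(** With u, v the two products, v <= (1 + eta) u is immediate. Conversely u <= v + eta u, and u <=
    (b / a) v turns this into a multiple of v without dividing by 1 - eta. *)
Lemma deviation_within_factor (m n : nat) (a b eta : R) (B B' : 'M[R]_(m, n))
    (y : 'rV[R]_n) :
  0 < a -> a <= b -> 0 <= eta -> positive_mx y ->
  entries_in a b B -> entries_in a b B' ->
  (forall i, `|(y *m (B' - B)^T) 0 i| <= eta * (y *m B^T) 0 i) ->
  within_factor (1 + b / a * eta) (y *m B^T) (y *m B'^T).
Proof.
move=> a0 ab eta0 y0 Bab B'ab dev i; move: (dev i).
rewrite mul_trB.
have h1 := mul_tr_le i a0 ab y0 Bab B'ab.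
have k1 : 1 <= b / a by rewrite ler_pdivlMr// mul1r.
have B0 : 0 <= (y *m B^T) 0 i.
  rewrite mul_trE sumr_ge0// => j _.
  by rewrite mulr_ge0 ?ltW//; exact: entries_in_positive Bab _ _.
move: h1 k1 B0; set u := (y *m B^T) 0 i; set v := (y *m B'^T) 0 i.
set k := b / a => h1 k1 B0; rewrite ler_norml => /andP[d1 d2].
have := ler_wpM2l eta0 h1.
have := ler_wpM2r (mulr_ge0 eta0 B0) k1.
by split; lra.
Qed.

(** The final error factor is exp (L k e) with e the capped deviation. Then exp s - 1 <= s exp s and
    e <= k give this constant; the cube comes from lam ^ 3 with lam <= 1 + k ^ 2, and (a / b) ^ 2 is
    the contraction constant. *)
Definition stability_const (a b : R) : R :=
  let k := b / a in let L := 1 + 4 * (1 + k ^+ 2) ^+ 3 / (a / b) ^+ 2 in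
  L * expR (L * k ^+ 2) * k.

Lemma rel_error_within_factor (n : nat) lam (u v : 'rV[R]_n) :
  1 <= lam -> positive_mx u -> within_factor lam u v -> rel_error v u <= lam - 1.
Proof.
move=> l1 u0 uv; apply: bigmax_le => [|i _]; first by rewrite subr_ge0.
rewrite mxE ler_pdivrMr//; have [uv1 uv2] := uv i.
have ui := u0 0 i; rewrite ler_norml; apply/andP; split; last by lra.
have l0 : 0 < lam by rewrite (lt_le_trans ltr01).
(* From p <= lam q follows lam (p - q) <= (lam - 1) p, which is below lam (lam - 1) p by exactly
   (lam - 1) ^ 2 p. *)
rewrite -(ler_pM2l l0); move: uv1 ui; set p := u 0 i; set q := v 0 i => *.
have : 0 <= (lam - 1) ^+ 2 * p by rewrite mulr_ge0 ?sqr_ge0// ltW.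
by rewrite expr2; lra.
Qed.

Lemma expR_sub1_le (s : R) : expR s - 1 <= s * expR s.
Proof.
rewrite lerBlDr -lerBlDl -[X in X - _]mul1r -mulrBl.
have := expR_ge1Dx (- s); rewrite expRN -(ler_pM2r (expR_gt0 s)).
by rewrite mulVf// gt_eqF// expR_gt0.
Qed.

Lemma scales_row_fit (m n : nat) (B : 'M[R]_(m, n)) (r x : 'rV[R]_m)
    (y : 'rV[R]_n) :
  (0 < n)%N -> positive_mx B -> positive_mx y ->
  (forall i, \sum_j x 0 i * B i j * y 0 j = r 0 i) -> x = row_fit B r y.
Proof.
move=> n0 B0 y0 rE; apply/rowP => i; rewrite [RHS]mxE -(rE i).
under eq_bigr do rewrite -mulrA.
rewrite -mulr_sumr -mul_trE mulfK// gt_eqF//; exact: positive_mul_tr.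
Qed.

Lemma scales_col_fit (m n : nat) (B : 'M[R]_(m, n)) (c y : 'rV[R]_n)
    (x : 'rV[R]_m) :
  (0 < m)%N -> positive_mx B -> positive_mx x ->
  (forall j, \sum_i x 0 i * B i j * y 0 j = c 0 j) -> y = row_fit B^T c x.
Proof.
move=> m0 B0 x0 cE; apply: scales_row_fit => // [|j]; first exact: positive_tr.
by rewrite -(cE j); apply: eq_bigr => i _; rewrite mxE mulrAC [y 0 j * _]mulrC mulrAC.
Qed.

(** For A, x and y are fits of each other. Hence the first step for B moves y only by the relative
    change lam of the row and column sums, and contraction bounds the whole remaining drift by this
    first move. *)
Lemma sinkhorn_stable (m n : nat) (A B : 'M[R]_(m, n)) r c x y a b eta :
  (0 < m)%N -> (0 < n)%N -> positive_mx r -> positive_mx c ->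
  \sum_i r 0 i = \sum_j c 0 j ->
  0 < a -> a <= b -> entries_in a b A -> entries_in a b B ->
  positive_mx x -> positive_mx y -> scales x y A r c -> 0 <= eta ->
  (forall i, `|(y *m (B - A)^T) 0 i| <= eta * (y *m A^T) 0 i) ->
  (forall j, `|(x *m (B^T - A^T)^T) 0 j| <= eta * (x *m A^T^T) 0 j) ->
  scaling_error x y (row_fit B r (sinkhorn_lim B r c y)) (sinkhorn_lim B r c y)
    <= stability_const a b * eta.
Proof.
move=> m0 n0 r0 c0 rc a0 ab Aab Bab x0 y0 [Ar Ac] eta0 devr devc.
have b0 := lt_le_trans a0 ab.
pose k := b / a; have k1 : 1 <= k by rewrite ler_pdivlMr// mul1r.
have k0 := lt_le_trans ltr01 k1.
have A0 := entries_in_positive a0 Aab; have B0 := entries_in_positive a0 Bab.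
have AT0 := positive_tr A0; have BT0 := positive_tr B0.
(* The trivial bound k on the relative deviation makes the estimate hold without
   assuming eta small. *)
pose e := Num.min eta k.
have e0 : 0 <= e by rewrite le_min eta0 ltW.
pose lam := 1 + k * e.
have ke0 : 0 <= k * e by rewrite mulr_ge0// ltW.
have l1 : 1 <= lam by rewrite lerDl.
have Ay0 := positive_mul_tr n0 A0 y0; have By0 := positive_mul_tr n0 B0 y0.
have Ax0 := positive_mul_tr m0 AT0 x0; have Bx0 := positive_mul_tr m0 BT0 x0.
have wr : within_factor lam (y *m A^T) (y *m B^T).
  apply: deviation_within_factor => // i; rewrite /e minEle; case: ifP => _ //.
  exact: deviation_trivial.
have wc : within_factor lam (x *m A^T^T) (x *m B^T^T).
  apply: deviation_within_factor => //; [exact: entries_in_tr..|].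
  move=> j; rewrite /e minEle; case: ifP => _ //.
  by apply: deviation_trivial => //; exact: entries_in_tr.
have xE := scales_row_fit n0 A0 y0 Ar.
have yE := scales_col_fit m0 A0 x0 Ac.
pose x1 := row_fit B r y; pose y1 := sinkhorn_step B r c y.
have x10 : positive_mx x1 by exact: positive_row_fit.
have y10 : positive_mx y1 by exact: positive_row_fit.
have xx1 : within_factor lam x x1 by rewrite xE; exact: within_factor_div.
(* One factor lam replaces A by B in the column fit of x, the other replaces x by x1. *)
have yy1 : within_factor (lam * lam) y y1.
  rewrite {1}yE; apply: (@within_factor_trans _ _ _ _ _ (row_fit B^T c x)).
  - exact: le_trans ler01 l1.
  - exact: le_trans ler01 l1.
  - exact: within_factor_div.
  - exact: within_factor_row_fit.
pose rho := (lam * lam) ^+ 2 - 1.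
have rho0 : 0 <= rho by rewrite subr_ge0 exprn_ege1// mulr_ege1.
have h : osc rho y y1 by apply: osc_of_within_factor => //; exact: mulr_ege1.
pose theta := (a / b) ^+ 2.
have th0 : 0 < theta by rewrite exprn_gt0// divr_gt0.
have th : 0 < theta <= 1.
  by rewrite th0 exprn_ile1 ?ler_pdivrMr ?mul1r// divr_ge0// ltW.
have Bt : cross_ratio theta B by exact: cross_ratio_entries_in.
have [_ z0 yz] := sinkhorn_cvg m0 n0 B0 r0 c0 y0 rc th rho0 Bt h.
set z := sinkhorn_lim B r c y in z0 yz *.
pose L := 4 * (1 + k ^+ 2) ^+ 3 / theta.
have L0 : 0 <= L.
  by rewrite divr_ge0 ?(ltW th0)// mulr_ge0// exprn_ge0// addr_ge0// sqr_ge0.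
(* rho = lam ^ 4 - 1 has the factor lam - 1 = k e; the cap e <= k bounds lam by 1 + k ^ 2, hence the
   cofactor by 4 (1 + k ^ 2) ^ 3. *)
have rhoL : rho / theta <= L * (k * e).
  rewrite /L mulrAC ler_pM2r ?invr_gt0//.
  have lk : lam <= 1 + k ^+ 2.
    by rewrite /lam lerD2l expr2 ler_pM2l// /e ge_min lexx orbT.
  have l0 : 0 <= lam by exact: le_trans ler01 l1.
  have -> : rho = (lam ^+ 3 + lam ^+ 2 + lam + 1) * (k * e).
    by rewrite /rho (_ : k * e = lam - 1); [ring|rewrite /lam addrAC subrr add0r].
  apply: ler_wpM2r => //; apply: (@le_trans _ _ (4 * lam ^+ 3)).
    have h1 : lam ^+ 2 <= lam ^+ 3 by exact: ler_weXn2l.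
    have h2 : lam <= lam ^+ 3 by rewrite -{1}[lam]expr1; exact: ler_weXn2l.
    have h3 : 1 <= lam ^+ 3 by exact: exprn_ege1.
    by lra.
  by rewrite ler_pM2l//; apply: lerXn2r => //; rewrite nnegrE// (le_trans l0).
(* A common factor for both vectors: y drifts by exp (rho / theta), and x carries in addition lam <=
   exp (k e) from its own first fit. *)
pose E := expR ((1 + L) * (k * e)).
have E1 : 1 <= E by rewrite -expR0 ler_expR mulr_ge0// addr_ge0.
have lamE : lam * expR (rho / theta) <= E.
  have -> : E = expR (k * e) * expR (L * (k * e)) by rewrite -expRD /E mulrDl mul1r.
  apply: ler_pM => //.
  - exact: le_trans ler01 l1.
  - exact: expR_ge1Dx.
  - by rewrite ler_expR.
have within_le (p : nat) (u v : 'rV[R]_p) mu : positive_mx u -> positive_mx v ->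
    mu <= E -> within_factor mu u v -> within_factor E u v.
  move=> u0 v0 muE uv i; have [uv1 uv2] := uv i; split.
    by rewrite (le_trans uv1)// ler_wpM2r// ltW.
  by rewrite (le_trans uv2)// ler_wpM2r// ltW.
have wy : within_factor E y z.
  apply: within_le yz => //; apply: le_trans lamE.
  by rewrite ler_peMl// expR_ge0.
have wx : within_factor E x (row_fit B r z).
  have : within_factor (lam * expR (rho / theta)) x (row_fit B r z).
    apply: within_factor_trans xx1 _; [exact: le_trans ler01 l1|exact: expR_ge0|].
    exact: within_factor_row_fit.
  by apply: within_le => //; exact: positive_row_fit.
apply: (@le_trans _ _ (E - 1)).
  by rewrite ge_max !rel_error_within_factor.
apply: (le_trans (expR_sub1_le _)).
have ek : e <= k by rewrite ge_min lexx orbT.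
have ee : e <= eta by rewrite ge_min lexx.
rewrite /stability_const -/k -/theta -/L.
rewrite [leRHS](_ : _ = (1 + L) * (k * eta) * expR ((1 + L) * k ^+ 2)); last first.
  by ring.
have L10 : 0 <= 1 + L by exact: addr_ge0.
apply: ler_pM; [exact: mulr_ge0|exact: expR_ge0|..].
  by rewrite ler_wpM2l// ler_pM2l.
by rewrite ler_expR ler_wpM2l// expr2 ler_pM2l.
Qed.


End Stability.

(** * Hoeffding's inequality *)

Section Independence.
Context d (T : measurableType d) (R : realType) (P : probability T R).

Import HBNNSimple.

(** Monotone convergence along simple functions that approximate f on the real line, not on the
    sample space: the right-hand side then sees G only through its integrals against indicators of
    events of X. *)
Lemma ge0_integral_comp_approx (X G : T -> R) (f : R -> R)
    (mf : measurable_fun [set: R] (fun u => (f u)%:E)) :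
  measurable_fun [set: T] X -> measurable_fun [set: T] G ->
  (forall w, 0 <= G w) -> (forall u, 0 <= f u) ->
  (\int[P]_w (f (X w) * G w)%:E =
   limn (fun n => \sum_(k \in range (nnsfun_approx measurableT mf n))
     k%:E * \int[P]_w
       (\1_(nnsfun_approx measurableT mf n @^-1` [set k]) (X w) * G w)%:E))%E.
Proof.
move=> mX mG G0 f0.
pose g := nnsfun_approx measurableT mf.
have mgX n : measurable_fun [set: T] (fun w => (g n (X w) * G w)%:E).
  apply/measurable_EFinP; apply: measurable_funM => //.
  by apply: measurableT_comp => //; exact: measurable_funP.
transitivity (limn (fun n => \int[P]_w (g n (X w) * G w)%:E)%E).
  rewrite -monotone_convergence//.
  - apply: eq_integral => w _; apply/esym/cvg_lim => //.
    rewrite EFinM; under eq_fun do rewrite EFinM.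
    apply: cvgeZr => //.
    have := @cvg_nnsfun_approx _ _ _ _ measurableT _ mf _ (X w) I.
    by apply => u _; rewrite lee_fin.
  - by move=> n w _; rewrite lee_fin mulr_ge0.
  - move=> w _ m n mn; rewrite lee_fin ler_wpM2r//.
    exact/lefP/nd_nnsfun_approx.
congr (limn _); apply/funext => n /=; rewrite -/(g n).
transitivity (\sum_(k \in range (g n))
    \int[P]_w (k * \1_(g n @^-1` [set k]) (X w) * G w)%:E)%E.
  rewrite -ge0_integral_fsum//.
  - apply: eq_integral => w _; rewrite fimfunE EFinM -fsumEFin//.
    rewrite ge0_mule_fsuml// => k.
    by rewrite EFinM nnfun_muleindic_ge0.
  - move=> k; apply/measurable_EFinP; apply: measurable_funM => //.
    by apply: measurable_funM => //; apply: measurableT_comp.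
  - move=> k w _; rewrite EFinM; apply: mule_ge0; last by rewrite lee_fin.
    by rewrite EFinM nnfun_muleindic_ge0.
apply: eq_fsbigr => k; rewrite inE => -[u _ <-].
under eq_integral do rewrite -mulrA EFinM.
rewrite ge0_integralZl//.
- apply/measurable_EFinP; apply: measurable_funM => //.
  by apply: measurableT_comp.
- by move=> w _; rewrite lee_fin mulr_ge0.
- by rewrite lee_fin.
Qed.

Lemma eq_integral_comp (X G1 G2 : T -> R) (f : R -> R) :
  measurable_fun [set: T] X -> measurable_fun [set: T] G1 ->
  measurable_fun [set: T] G2 -> (forall w, 0 <= G1 w) -> (forall w, 0 <= G2 w) ->
  measurable_fun [set: R] f -> (forall u, 0 <= f u) ->
  (forall B, measurable B -> \int[P]_w (\1_B (X w) * G1 w)%:E =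
    \int[P]_w (\1_B (X w) * G2 w)%:E)%E ->
  (\int[P]_w (f (X w) * G1 w)%:E = \int[P]_w (f (X w) * G2 w)%:E)%E.
Proof.
move=> mX mG1 mG2 G10 G20 mf f0 G12.
have mf' : measurable_fun [set: R] (fun u => (f u)%:E) by exact/measurable_EFinP.
rewrite !(ge0_integral_comp_approx mf')//; congr (limn _).
by apply/funext => n; apply: eq_fsbigr => k _; rewrite G12.
Qed.

(** Independence is the case of indicator functions. At each index, with the other factors merged
    into one weight, [eq_integral_comp] passes from indicators to nonnegative measurable
    functions. *)
Lemma integral_prod_indep (I : finType) (X : I -> T -> R) (f : I -> R -> R) :
  (forall i, measurable_fun [set: T] (X i)) -> mutually_independent P X ->
  (forall i, measurable_fun [set: R] (f i)) -> (forall i u, 0 <= f i u) ->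
  (forall i, \int[P]_w (f i (X i w))%:E \is a fin_num)%E ->
  (\int[P]_w (\prod_i f i (X i w))%:E = \prod_i \int[P]_w (f i (X i w))%:E)%E.
Proof.
move=> mX indep.
have mpreim i B : measurable B -> measurable (X i @^-1` B).
  by move=> mB; rewrite -[X in measurable X]setTI; exact: mX.
have integral_ind i B : measurable B ->
    (\int[P]_w (\1_B (X i w))%:E)%E = P (X i @^-1` B).
  move=> mB; transitivity (\int[P]_w (\1_(X i @^-1` B) w)%:E)%E; first by [].
  by rewrite integral_indic ?setIT//; exact: mpreim.
pose indicator (g : R -> R) := exists2 B, measurable B & g = \1_B.
(* Indicators are replaced by arbitrary functions one index at a time. *)
suff key (s : seq I) : forall f : I -> R -> R,
    (forall i, measurable_fun [set: R] (f i)) -> (forall i u, 0 <= f i u) ->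
    (forall i, \int[P]_w (f i (X i w))%:E \is a fin_num)%E ->
    (forall i, i \notin s -> indicator (f i)) ->
    (\int[P]_w (\prod_i f i (X i w))%:E = \prod_i \int[P]_w (f i (X i w))%:E)%E.
  by move=> mf f0 fin; apply: (key (enum I)) => // i; rewrite mem_enum.
elim: s => [|k s IHs] {}f mf f0 fin ind.
  have /choice[B HB] : forall i, exists B, measurable B /\ f i = \1_B.
    by move=> i; have [//|B mB fB] := ind i; exists B.
  transitivity (\int[P]_w (\1_(\bigcap_(i in [set` [set: I]%SET]) (X i @^-1` B i)) w)%:E)%E.
    apply: eq_integral => w _; congr EFin; rewrite indicE.
    under eq_bigr do rewrite (HB _).2 indicE.
    have [wB|/existsNP[i nB]] := pselect (forall i, B i (X i w)).
      rewrite big1 => [|i _]; last by rewrite mem_set//; exact: wB.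
      by rewrite mem_set// => i _; exact: wB.
    rewrite (bigD1 i)//= memNset// mul0r memNset// => /(_ i); apply: contra_not nB.
    by apply; rewrite /= inE.
  rewrite integral_indic //; last first.
    apply: fin_bigcap_measurable => [|i _]; first exact: finite_finset.
    by apply: mpreim; exact: (HB i).1.
  rewrite setIT; apply: etrans (indep [set: I]%SET B _) _ => [i _|]; first exact: (HB i).1.
  rewrite big_mkcond /=; apply: eq_bigr => i _; rewrite inE.
  by rewrite (HB i).2 integral_ind//; exact: (HB i).1.
pose F i := fine (\int[P]_w (f i (X i w))%:E)%E.
have FE i : (\int[P]_w (f i (X i w))%:E)%E = (F i)%:E by rewrite fineK.
have F0 i : 0 <= F i by apply: fine_ge0; apply: integral_ge0 => w _; rewrite lee_fin.
have mprod : measurable_fun [set: T] (fun w => \prod_(i | i != k) f i (X i w)).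
  rewrite [X in measurable_fun _ X](_ : _ =
    fun w => \prod_(i <- [seq i <- index_enum I | i != k]) f i (X i w)); last first.
    by apply/funext => w; rewrite big_filter.
  by apply: measurable_prod => i _; exact: measurableT_comp.
have cstE (g : R -> R) : measurable_fun [set: R] g -> (forall u, 0 <= g u) ->
    (\int[P]_w (g (X k w) * cst (\prod_(i | i != k) F i) w)%:E =
     \int[P]_w (g (X k w))%:E * (\prod_(i | i != k) F i)%:E)%E.
  move=> mg g0; under eq_integral do rewrite EFinM /=.
  rewrite ge0_integralZr//=.
  - by apply/measurable_EFinP; exact: measurableT_comp.
  - by move=> w _; rewrite lee_fin.
  - by rewrite lee_fin prodr_ge0.
transitivity (\int[P]_w (f k (X k w) * \prod_(i | i != k) f i (X i w))%:E)%E.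
  by apply: eq_integral => w _; rewrite (bigD1 k).
(* The random weight formed by the other factors is compared with the constant product of their
   integrals. *)
rewrite (@eq_integral_comp _ _ (cst (\prod_(i | i != k) F i)))//.
- rewrite cstE// [in RHS](bigD1 k)//= -prodEFin; congr (_ * _)%E.
  by apply: eq_bigr => i _; rewrite FE.
- by move=> w; exact: prodr_ge0.
- by move=> w; exact: prodr_ge0.
move=> B mB; rewrite cstE; [|exact: measurable_indic|by move=> u; rewrite indicE].
(* With an indicator at k, the family may differ from indicators only on s, so the induction
   hypothesis applies. *)
pose f' i := if i == k then \1_B else f i.
have f'k i : i != k -> f' i = f i by rewrite /f' => /negPf ->.
have f'B : f' k = \1_B by rewrite /f' eqxx.
transitivity (\int[P]_w (\prod_i f' i (X i w))%:E)%E.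
  apply: eq_integral => w _; rewrite [in RHS](bigD1 k)//= f'B; congr (_ * _)%:E.
  by apply: eq_bigr => i ik; rewrite f'k.
rewrite IHs.
- rewrite [in LHS](bigD1 k)//= f'B -prodEFin; congr (_ * _)%E.
  by apply: eq_bigr => i ik; rewrite f'k// FE.
- by move=> i; rewrite /f'; case: eqP => // _; exact: measurable_indic.
- by move=> i u; rewrite /f'; case: eqP => // _; rewrite indicE.
- move=> i; rewrite /f'; case: eqP => [->|//].
  by rewrite integral_ind// fin_num_measure//; exact: mpreim.
- move=> i; rewrite /f'; case: eqP => [_ _|ik iS]; first by exists B.
  by apply: ind; rewrite inE negb_or iS andbT; exact/eqP.
Qed.

End Independence.

(** For z > 1/2, z <= 2 z ^ 2. Otherwise exp z <= 1 / (1 - z) <= 1 + z + 2 z ^ 2, the last gap being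
    z ^ 2 (1 - 2 z) after multiplication by 1 - z. *)
Lemma expR_le_addr_expR_sqr (R : realType) (z : R) :
  expR z <= z + expR (2 * z ^+ 2).
Proof.
have [z2|z2] := leP z (1 / 2); last first.
  apply: (@le_trans _ _ (expR (2 * z ^+ 2))); last by rewrite lerDr; lra.
  by rewrite ler_expR expr2; nra.
apply: (@le_trans _ _ (z + (1 + 2 * z ^+ 2))); last by rewrite lerD2l expR_ge1Dx.
have z1 : 0 < 1 - z by lra.
have e1 : expR z * (1 - z) <= 1.
  rewrite -[leRHS](mulfV (lt0r_neq0 (expR_gt0 z))) -expRN ler_pM2l ?expR_gt0//.
  exact: expR_ge1Dx.
rewrite -(ler_pM2r z1) (le_trans e1)//.
have : 0 <= z ^+ 2 * (1 - 2 * z) by rewrite mulr_ge0 ?sqr_ge0//; lra.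
by rewrite !expr2; lra.
Qed.

Section Hoeffding.
Context d (T : measurableType d) (R : realType) (P : probability T R).

Lemma bounded_integrable (Z : T -> R) c : measurable_fun [set: T] Z ->
  (forall w, `|Z w| <= c) -> P.-integrable [set: T] (EFin \o Z).
Proof.
move=> mZ Zc.
apply: (@le_integrable _ _ _ P _ measurableT _ (EFin \o cst c)).
- exact/measurable_EFinP.
- by move=> w _ /=; rewrite lee_fin (le_trans (Zc w))// ler_norm.
- by apply: finite_measure_integrable_cst.
Qed.

(** Hoeffding's lemma with 2 in place of the sharp 1/2: the linear term of [expR_le_addr_expR_sqr]
    integrates to zero. *)
Lemma integral_expR_le (Z : T -> R) c : measurable_fun [set: T] Z ->
  (forall w, `|Z w| <= c) -> (\int[P]_w (Z w)%:E = 0)%E ->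
  (\int[P]_w (expR (Z w))%:E <= (expR (2 * c ^+ 2))%:E)%E.
Proof.
move=> mZ Zc Z0.
have ZE w : expR (Z w) <= Z w + expR (2 * c ^+ 2).
  apply: le_trans (expR_le_addr_expR_sqr _) _; rewrite lerD2l ler_expR ler_pM2l//.
  rewrite -(real_normK (num_real (Z w))); apply: lerXn2r; rewrite ?nnegrE//.
  by rewrite (le_trans _ (Zc w)).
apply: (@le_trans _ _ (\int[P]_w ((Z w)%:E + (expR (2 * c ^+ 2))%:E))%E).
  apply: ge0_le_integral => //.
  - by apply/measurable_EFinP; exact: measurableT_comp.
  - by apply: emeasurable_funD => //; exact/measurable_EFinP.
  - by move=> w _; rewrite -EFinD lee_fin.
rewrite integralD//=.
- by rewrite Z0 add0e integral_cst//= probability_setT mule1.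
- exact: bounded_integrable Zc.
- exact: finite_measure_integrable_cst.
Qed.

(** Chernoff's bound; independence factors the moment generating function and each factor is
    sub-Gaussian. *)
Lemma hoeffding_upper (I : finType) (X : I -> T -> R) (mu w : I -> R) (D t : R) :
  (forall i, measurable_fun [set: T] (X i)) -> mutually_independent P X ->
  (forall i o, `|X i o - mu i| <= D) ->
  (forall i, \int[P]_o (X i o)%:E = (mu i)%:E)%E ->
  0 < t -> 0 < D -> 0 < \sum_i w i ^+ 2 ->
  (P [set o | (t <= \sum_i w i * (X i o - mu i))%R] <=
   (expR (- (t ^+ 2 / (8 * D ^+ 2 * \sum_i w i ^+ 2))))%:E)%E.
Proof.
move=> mX indep XD EX t0 D0; set V := \sum_i _ => V0.
pose S o := \sum_i w i * (X i o - mu i).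
have mXw i : measurable_fun [set: T] (fun o => w i * (X i o - mu i)).
  by apply: measurable_funM => //; exact: measurable_funB.
have mS : measurable_fun [set: T] S by exact: measurable_sum.
pose SX : {RV P >-> R} := HB.pack S (isMeasurableFun.Build _ _ _ _ S mS).
(* The minimizer of [2 * la ^+ 2 * D ^+ 2 * V - la * t]. *)
pose la := t / (4 * D ^+ 2 * V).
have la0 : 0 < la by rewrite divr_gt0// !mulr_gt0// exprn_gt0.
apply: (le_trans (chernoff SX t la0)).
have centered i : (\int[P]_o (X i o - mu i)%:E = 0)%E.
  transitivity (\int[P]_o (X i o)%:E - \int[P]_o (cst (mu i) o)%:E)%E.
    rewrite -integralB_EFin//; last exact: finite_measure_integrable_cst.
    apply: (@bounded_integrable _ (D + `|mu i|)) => // o.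
    by rewrite -[X i o](subrK (mu i)) (le_trans (ler_normD _ _))// lerD2r.
  by rewrite EX (integral_cst P measurableT (mu i)%:E) /= probability_setT mule1 subee.
pose f i u := expR (la * (w i * (u - mu i))).
have mf i : measurable_fun [set: R] (f i).
  apply: measurableT_comp => //; apply: measurable_funM => //.
  by apply: measurable_funM => //; exact: measurable_funB.
have fX i : (\int[P]_o (f i (X i o))%:E <= (expR (2 * (la * w i * D) ^+ 2))%:E)%E.
  apply: le_trans (@integral_expR_le _ (`|la * w i * D|) _ _ _) _.
  - by apply: measurable_funM.
  - move=> o; rewrite mulrA normrM [leRHS]normrM (gtr0_norm D0).
    by rewrite ler_wpM2l// XD.
  - under eq_integral do rewrite mulrA EFinM.
    rewrite integralZl//.
    + by rewrite centered mule0.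
    + by apply: bounded_integrable (XD i); exact: measurable_funB.
  - by rewrite real_normK// num_real.
have fin i : (\int[P]_o (f i (X i o))%:E \is a fin_num)%E.
  rewrite ge0_fin_numE; first exact: le_lt_trans (fX i) (ltry _).
  by apply: integral_ge0 => o _; rewrite lee_fin expR_ge0.
have -> : ('M_P SX la = \prod_i \int[P]_o (f i (X i o))%:E)%E.
  rewrite -integral_prod_indep// => [|i u]; last exact: expR_ge0.
  rewrite /mmt_gen_fun unlock; apply: eq_integral => o _ /=.
  by rewrite -expR_sum -mulr_sumr mulrC.
pose F i := fine (\int[P]_o (f i (X i o))%:E)%E.
have FE i : (\int[P]_o (f i (X i o))%:E)%E = (F i)%:E by rewrite fineK.
under eq_bigr do rewrite FE.
rewrite prodEFin -EFinM lee_fin.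
apply: (@le_trans _ _ (\prod_i expR (2 * (la * w i * D) ^+ 2) * expR (- (la * t)))).
  rewrite ler_wpM2r ?expR_ge0//; apply: ler_prod => i _; apply/andP; split.
    by rewrite fine_ge0// integral_ge0// => o _; rewrite lee_fin expR_ge0.
  by rewrite -lee_fin -FE.
rewrite -expR_sum -expRD ler_expR.
under eq_bigr do rewrite !exprMn.
rewrite -mulr_sumr -mulr_suml -mulr_sumr -/V /la.
rewrite le_eqVlt; apply/orP; left; apply/eqP.
by field; rewrite !gt_eqF.
Qed.

(** The lower tail is the upper tail for the weights - w. *)
Lemma hoeffding (I : finType) (X : I -> T -> R) (mu w : I -> R) (D t : R) :
  (forall i, measurable_fun [set: T] (X i)) -> mutually_independent P X ->
  (forall i o, `|X i o - mu i| <= D) ->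
  (forall i, \int[P]_o (X i o)%:E = (mu i)%:E)%E ->
  0 < t -> 0 < D -> 0 < \sum_i w i ^+ 2 ->
  (P [set o | (t <= `|\sum_i w i * (X i o - mu i)|)%R] <=
   (2 * expR (- (t ^+ 2 / (8 * D ^+ 2 * \sum_i w i ^+ 2))))%:E)%E.
Proof.
move=> mX indep XD EX t0 D0 V0.
have mE (v : I -> R) : measurable [set o | t <= \sum_i v i * (X i o - mu i)].
  rewrite (_ : [set o | _] = (fun o => \sum_i v i * (X i o - mu i)) @^-1` `[t, +oo[).
    rewrite -[X in measurable X]setTI; apply: measurable_sum => // i.
    by apply: measurable_funM => //; exact: measurable_funB.
  by apply/seteqP; split => o /=; rewrite in_itv/= andbT.
rewrite (_ : [set o | _] = [set o | t <= \sum_i w i * (X i o - mu i)] `|`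
    [set o | t <= \sum_i (- w i) * (X i o - mu i)]); last first.
  apply/seteqP; split => o /=; under [in X in _ \/ X]eq_bigr do rewrite mulNr.
    by rewrite sumrN ler_normr => /orP.
  by rewrite sumrN ler_normr => /orP.
apply: le_trans (measureU2 _ (mE _) (mE _)) _.
rewrite mulr_natl mulr2n EFinD; apply: leeD; first exact: hoeffding_upper.
have -> : \sum_i w i ^+ 2 = \sum_i (- w i) ^+ 2 by apply: eq_bigr => i _; rewrite sqrrN.
apply: hoeffding_upper => //.
by under eq_bigr do rewrite sqrrN.
Qed.

End Hoeffding.

(** * Deviation of the random scaling *)

Section Ratios.
Variable R : realType.

(** Products of two rows with y differ by a factor at most b / a, and the entries of r by at most C.
    Applied to A, this makes the entries of each scaling vector comparable uniformly in the
    dimensions. *)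
Lemma row_fit_ratio (m n : nat) (a b C : R) (B : 'M[R]_(m, n)) r y :
  (0 < n)%N -> 0 < a -> a <= b -> entries_in a b B ->
  positive_mx r -> positive_mx y -> (forall i k, r 0 i <= C * r 0 k) ->
  forall i k, row_fit B r y 0 i <= C * (b / a) * row_fit B r y 0 k.
Proof.
move=> n0 a0 ab Bab r0 y0 rC i k; rewrite ![row_fit _ _ _ _ _]mxE.
have b0 := lt_le_trans a0 ab; have B0 := entries_in_positive a0 Bab.
have s0 := positive_mul_tr n0 B0 y0.
have sik : (y *m B^T) 0 k <= b / a * (y *m B^T) 0 i.
  rewrite !mul_trE mulr_sumr; apply: ler_sum => j _.
  rewrite mulrA ler_wpM2r ?(ltW (y0 _ _))//.
  have /andP[_ /le_trans] := Bab k j; apply.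
  by rewrite mulrAC ler_pdivlMr// ler_pM2l//; have /andP[] := Bab i j.
rewrite ler_pdivrMr// mulrA mulrAC ler_pdivlMr//.
apply: (@le_trans _ _ (C * r 0 k * (b / a * (y *m B^T) 0 i))).
  apply: ler_pM => //; exact/ltW.
by rewrite le_eqVlt; apply/orP; left; apply/eqP; ring.
Qed.

Lemma le_max_entry (n : nat) (v : 'rV[R]_n) i : v 0 i <= max_entry v.
Proof. exact: (le_bigmax_cond _ (fun i => v 0 i)). Qed.

Lemma min_entry_le (n : nat) (v : 'rV[R]_n) i : min_entry v <= v 0 i.
Proof. exact: (bigmin_le_cond _ (fun i => v 0 i)). Qed.

Lemma min_entry_gt0 (n : nat) (v : 'rV[R]_n) :
  (0 < n)%N -> positive_mx v -> 0 < min_entry v.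
Proof.
move=> n0 v0; apply: lt_bigmin => //.
exact: lt_le_trans (v0 0 (Ordinal n0)) (le_max_entry _ _).
Qed.

Lemma entry_ratio (n : nat) (v : 'rV[R]_n) C : (0 < n)%N -> positive_mx v ->
  max_entry v / min_entry v <= C -> forall i k, v 0 i <= C * v 0 k.
Proof.
move=> n0 v0 vC i k; have mv := min_entry_gt0 n0 v0.
have C0 : 0 <= C.
  apply: le_trans vC; rewrite divr_ge0 ?(ltW mv)//.
  exact: le_trans (ltW (v0 0 i)) (le_max_entry _ _).
rewrite (le_trans (le_max_entry _ _))//.
apply: le_trans (ler_wpM2l C0 (min_entry_le v k)).
by rewrite -ler_pdivrMr.
Qed.

(** No weight dominates: the variance proxy is at most Q / n times the squared sum, which makes the
    Hoeffding exponent linear in n. *)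
Lemma sum_sqr_le (n : nat) (y : 'rV[R]_n) Q : positive_mx y ->
  (forall j k, y 0 j <= Q * y 0 k) ->
  n%:R * \sum_j y 0 j ^+ 2 <= Q * (\sum_j y 0 j) ^+ 2.
Proof.
move=> y0 yQ; rewrite expr2 mulrA !mulr_sumr; apply: ler_sum => j _.
rewrite expr2 mulrA ler_wpM2r ?(ltW (y0 _ _))//.
rewrite mulr_natl -[X in _ *+ X](card_ord n) -sumr_const.
by apply: ler_sum => k _; exact: yQ.
Qed.

Definition clip (a b u : R) := Num.max a (Num.min b u).

Lemma clip_in (a b u : R) : a <= b -> a <= clip a b u <= b.
Proof. by move=> ab; rewrite /clip le_max lexx ge_max ab ge_min lexx. Qed.

Lemma clip_id (a b u : R) : a <= u <= b -> clip a b u = u.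
Proof. by move=> /andP[au ub]; rewrite /clip min_r// max_r. Qed.

Lemma measurable_clip (a b : R) : measurable_fun [set: R] (clip a b).
Proof. by apply: measurable_maxr => //; exact: measurable_minr. Qed.

End Ratios.

(** * Measurability of the limit and tail bound for the scaling error *)

Section Probability.
Context d (T : measurableType d) (R : realType) (P : probability T R).

Lemma mutually_independent_comp (I : finType) (X : I -> T -> R) (f : R -> R) :
  measurable_fun [set: R] f -> mutually_independent P X ->
  mutually_independent P (fun i o => f (X i o)).
Proof.
move=> mf indep J B mB; apply: (indep J (fun i => f @^-1` B i)) => i iJ.
by rewrite -[X in measurable X]setTI; apply: mf => //; exact: mB.
Qed.

Lemma probability_bigU_le (I : finType) (F : I -> set T) (e : R) :
  (forall i, measurable (F i)) -> (forall i, P (F i) <= e%:E)%E ->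
  (P (\big[setU/set0]_i F i) <= (#|I|%:R * e)%:E)%E.
Proof.
move=> mF Fe; rewrite mulr_natl cardE.
have -> : \big[setU/set0]_i F i = \big[setU/set0]_(i <- enum I) F i by rewrite big_enum.
elim: (enum I) => [|i s IHs]; first by rewrite big_nil measure0.
rewrite big_cons /= mulrS EFinD; apply: le_trans (measureU2 _ _ _) _ => //.
  exact: bigsetU_measurable.
by apply: leeD; [exact: Fe|exact: IHs].
Qed.

Lemma row_deviation (m n : nat) (a b Q s : R) (B : T -> 'M[R]_(m, n))
    (A : 'M[R]_(m, n)) (y : 'rV[R]_n) i :
  (0 < n)%N -> 0 < a -> a <= b -> 0 < Q -> 0 < s -> random_mx B ->
  (forall o, entries_in a b (B o)) -> entries_in a b A ->
  (forall i j, \int[P]_o (B o i j)%:E = (A i j)%:E)%E ->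
  mutually_independent P (fun j o => B o i j) ->
  positive_mx y -> (forall j k, y 0 j <= Q * y 0 k) ->
  (P [set o | (s * (y *m A^T) 0 i <= `|(y *m (B o - A)^T) 0 i|)%R] <=
   (2 * expR (- (s ^+ 2 * (a ^+ 2 / (8 * b ^+ 2 * Q)) * n%:R)))%:E)%E.
Proof.
move=> n0 a0 ab Q0 s0 mB Bab Aab EB indep y0 yQ.
have b0 := lt_le_trans a0 ab; have A0 := entries_in_positive a0 Aab.
have Ay0 : 0 < (y *m A^T) 0 i by exact: positive_mul_tr.
have V0 : 0 < \sum_j y 0 j ^+ 2.
  by apply: sumr_pos => // j; rewrite exprn_gt0.
rewrite (_ : [set o | _] =
    [set o | s * (y *m A^T) 0 i <= `|\sum_j y 0 j * (B o i j - A i j)|]); last first.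
  apply: eq_set => o; congr (is_true (_ <= `|_|)); rewrite [LHS]mul_trE.
  by apply: eq_bigr => j _; rewrite !mxE mulrC.
(* D = b is admissible since both entries lie in [a, b] with a > 0. The level t = s (A y)_i is at
   least s a times the sum of y, to be played against [sum_sqr_le]. *)
apply: le_trans (hoeffding (D := b) (mu := A i) _ indep _ _ _ b0 V0) _ => //.
- by move=> j o; have /andP[] := Bab o i j; have /andP[] := Aab i j;
     rewrite ler_norml; move=> *; apply/andP; split; lra.
- exact: mulr_gt0.
rewrite lee_fin ler_pM2l// ler_expR lerN2 ler_pdivlMr ?mulr_gt0 ?exprn_gt0//.
set V := \sum_j _ in V0 *.
have VY := sum_sqr_le y0 yQ; rewrite -/V in VY.
set Y := \sum_j y 0 j in VY.
have aY : (a * Y) ^+ 2 <= ((y *m A^T) 0 i) ^+ 2.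
  apply: lerXn2r; rewrite ?nnegrE ?(ltW Ay0)//.
    by rewrite mulr_ge0 ?(ltW a0)// sumr_ge0// => j _; exact: ltW.
  rewrite mul_trE mulr_sumr; apply: ler_sum => j _.
  by rewrite ler_wpM2r ?(ltW (y0 _ _))//; have /andP[] := Aab i j.
rewrite exprMn.
rewrite (_ : _ * (8 * _ * V) = s ^+ 2 * (a ^+ 2 / Q * (n%:R * V))); last first.
  by field; rewrite !gt_eqF.
rewrite ler_pM2l ?exprn_gt0//; apply: le_trans aY.
rewrite mulrAC ler_pdivrMr// [(a * Y) ^+ 2]exprMn -[leRHS]mulrA ler_pM2l ?exprn_gt0//.
by rewrite [leRHS]mulrC.
Qed.

Lemma measurable_max_entry (n : nat) (v : T -> 'rV[R]_n) : random_mx v ->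
  measurable_fun [set: T] (fun o => max_entry (v o)).
Proof.
move=> mv; rewrite /max_entry unlock; elim: (index_enum _) => //= i s IHs.
exact: measurable_maxr.
Qed.

Lemma measurable_divr (f g : T -> R) : measurable_fun [set: T] f ->
  measurable_fun [set: T] g -> (forall o, 0 <= g o) ->
  measurable_fun [set: T] (fun o => f o / g o).
Proof.
move=> mf mg g0; apply: measurable_funM => //.
(* On nonnegative reals, zero included, the inverse is the power -1, which is measurable. *)
rewrite (_ : (fun o => _) = (fun o => powR (g o) (-1))).
  exact: (measurableT_comp (measurable_powR (-1)) mg).
by apply/funext => o; rewrite powR_inv1.
Qed.

Lemma random_row_fit (m n : nat) (B : T -> 'M[R]_(m, n)) r (y : T -> 'rV[R]_n) :
  (forall o, positive_mx (B o)) -> (forall o, positive_mx (y o)) ->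
  random_mx B -> random_mx y -> random_mx (fun o => row_fit (B o) r (y o)).
Proof.
move=> B0 y0 mB my i j; rewrite (_ : (fun o => _) =
    (fun o => r 0 j / \sum_k B o j k * y o 0 k)); last first.
  by apply/funext => o; rewrite mxE mul_trE.
apply: measurable_divr => //.
- by apply: measurable_sum => k; exact: measurable_funM.
- by move=> o; apply: sumr_ge0 => k _; rewrite mulr_ge0// ltW//; [exact: B0|exact: y0].
Qed.

Lemma random_tr (m n : nat) (B : T -> 'M[R]_(m, n)) :
  random_mx B -> random_mx (fun o => (B o)^T).
Proof. by move=> mB i j; under eq_fun do rewrite mxE; exact: mB. Qed.

(** Every iterate is a measurable function of the outcome, as the start y is deterministic, and the
    iterates converge at every outcome. *)
Lemma random_sinkhorn_lim (m n : nat) (B : T -> 'M[R]_(m, n)) r c y :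
  (0 < m)%N -> (0 < n)%N -> (forall o, positive_mx (B o)) -> random_mx B ->
  positive_mx r -> positive_mx c -> positive_mx y ->
  \sum_i r 0 i = \sum_j c 0 j ->
  random_mx (fun o => sinkhorn_lim (B o) r c y).
Proof.
move=> m0 n0 B0 mB r0 c0 y0 rc i j; rewrite ord1.
apply: (@measurable_fun_cvg _ _ _ _ (fun k o => sinkhorn (B o) r c y k 0 j)); last first.
  by move=> o _; have [] := sinkhorn_lim_correct m0 n0 (B0 o) r0 c0 y0 rc.
move=> k; have : random_mx (fun o => sinkhorn (B o) r c y k).
  elim: k => [|k IHk]; first by move=> i' j'; exact: measurable_cst.
  apply: (@random_row_fit _ _ (fun o => (B o)^T)) => //.
  - by move=> o; exact: positive_tr.
  - by move=> o; apply: positive_row_fit => //; exact: positive_sinkhorn.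
  - exact: random_tr.
  - by apply: random_row_fit => // o; exact: positive_sinkhorn.
exact.
Qed.

Lemma integral_in (f : T -> R) (a b e : R) : 0 < a -> measurable_fun [set: T] f ->
  (forall o, a <= f o <= b) -> (\int[P]_o (f o)%:E = e%:E)%E -> a <= e <= b.
Proof.
move=> a0 mf fab fe; rewrite -!lee_fin -fe.
have cstE k : (\int[P]_o (cst k%:E o) = k%:E)%E.
  by rewrite integral_cst//= probability_setT mule1.
have f0 o : 0 <= f o by have /andP[/(le_trans (ltW a0))] := fab o.
apply/andP; split.
  rewrite -(cstE a); apply: ge0_le_integral => //.
  - by move=> o _; rewrite lee_fin ltW.
  - exact/measurable_EFinP.
  - by move=> o _; rewrite lee_fin; have /andP[] := fab o.
rewrite -(cstE b); apply: ge0_le_integral => //.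
- by move=> o _; rewrite lee_fin.
- exact/measurable_EFinP.
- by move=> o _; rewrite lee_fin; have /andP[] := fab o.
Qed.

(** [sinkhorn_stable] with eta = s holds off a null set and the deviation events. The m row events
    concern sums of n independent terms, the n column events sums of m, whence the two crossed
    products. *)
Lemma scaling_error_tail (m n : nat) (a b C s : R) (B : T -> 'M[R]_(m, n))
    (A : 'M[R]_(m, n)) r c x y :
  (0 < m)%N -> (0 < n)%N -> 0 < a -> a <= b -> 0 < C -> 0 < s ->
  positive_mx r -> positive_mx c -> \sum_i r 0 i = \sum_j c 0 j ->
  random_mx B -> (forall o, positive_mx (B o)) ->
  (forall i j, (A i j)%:E = 'E_P[fun o => B o i j])%E ->
  positive_mx x -> positive_mx y -> scales x y A r c ->
  (forall i j, {ae P, forall o, a <= B o i j <= b}) ->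
  (forall i, mutually_independent P (fun j o => B o i j)) ->
  (forall j, mutually_independent P (fun i o => B o i j)) ->
  (forall i k, r 0 i <= C * r 0 k) -> (forall j k, c 0 j <= C * c 0 k) ->
  let S := [set o | scaling_error x y
    (row_fit (B o) r (sinkhorn_lim (B o) r c y)) (sinkhorn_lim (B o) r c y)
    <= stability_const a b * s] in
  let k := a ^+ 2 / (8 * b ^+ 2 * (C * (b / a))) in
  measurable S /\
  (P (~` S) <= (m%:R * (2 * expR (- (s ^+ 2 * k * n%:R))) +
              n%:R * (2 * expR (- (s ^+ 2 * k * m%:R))))%:E)%E.
Proof.
move=> m0 n0 a0 ab C0 s0 r0 c0 rc mB B0 EA x0 y0 xyA Bab indr indc rC cC S k.
have b0 := lt_le_trans a0 ab.
have mz := random_sinkhorn_lim m0 n0 B0 mB r0 c0 y0 rc.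
have z0 o : positive_mx (sinkhorn_lim (B o) r c y).
  by have [] := sinkhorn_lim_correct m0 n0 (B0 o) r0 c0 y0 rc.
have mx := random_row_fit r B0 z0 mB mz.
have mrel p (u : 'rV[R]_p) (v : T -> 'rV[R]_p) : positive_mx u -> random_mx v ->
    measurable_fun [set: T] (fun o => rel_error (v o) u).
  move=> u0 mv; apply: measurable_max_entry => i j.
  under eq_fun do rewrite mxE.
  apply: measurable_funM => //; apply: measurableT_comp => //.
  exact: measurable_funB.
have mS : measurable S.
  rewrite (_ : S = (fun o => scaling_error x y
    (row_fit (B o) r (sinkhorn_lim (B o) r c y)) (sinkhorn_lim (B o) r c y))
    @^-1` `]-oo, stability_const a b * s]); last first.
    by apply/seteqP; split => o /=; rewrite in_itv.
  rewrite -[X in measurable X]setTI; apply: measurable_maxr => //; exact: mrel.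
split=> //.
(* B lies in [a, b] only almost surely; Hoeffding is applied to its truncation. *)
pose D o := map_mx (clip a b) (B o).
have mD : random_mx D.
  move=> i j; under eq_fun do rewrite mxE.
  by apply: measurableT_comp => //; exact: measurable_clip.
have Dab o : entries_in a b (D o) by move=> i j; rewrite mxE clip_in.
have ED i j : (\int[P]_o (D o i j)%:E = (A i j)%:E)%E.
  rewrite EA unlock; apply: ae_eq_integral => //; [exact/measurable_EFinP..|].
  by apply: filterS (Bab i j) => o Bo _; rewrite mxE clip_id.
have Aab : entries_in a b A.
  by move=> i j; apply: (integral_in a0 (mD i j) _ (ED i j)) => o; exact: Dab.
have indDr i : mutually_independent P (fun j o => D o i j).
  rewrite (_ : (fun j o => _) = fun j o => clip a b (B o i j)).
    apply: (@mutually_independent_comp _ (fun j o => B o i j)); last exact: indr.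
    exact: measurable_clip.
  by apply/funext => j; apply/funext => o; rewrite mxE.
have indDc j : mutually_independent P (fun i o => (D o)^T j i).
  rewrite (_ : (fun i o => _) = fun i o => clip a b (B o i j)).
    apply: (@mutually_independent_comp _ (fun i o => B o i j)); last exact: indc.
    exact: measurable_clip.
  by apply/funext => i; apply/funext => o; rewrite !mxE.
have A0 := entries_in_positive a0 Aab.
have [Ar Ac] := xyA.
have xE := scales_row_fit n0 A0 y0 Ar.
have yE := scales_col_fit m0 A0 x0 Ac.
have Q0 : 0 < C * (b / a) by rewrite mulr_gt0// divr_gt0.
have xQ : forall i j, x 0 i <= C * (b / a) * x 0 j.
  by rewrite xE; exact: row_fit_ratio.
have yQ : forall i j, y 0 i <= C * (b / a) * y 0 j.
  by rewrite yE; apply: row_fit_ratio => //; exact: entries_in_tr.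
pose E i := [set o | s * (y *m A^T) 0 i <= `|(y *m (D o - A)^T) 0 i|].
pose F j := [set o | s * (x *m A^T^T) 0 j <= `|(x *m ((D o)^T - A^T)^T) 0 j|].
have PE i : (P (E i) <= (2 * expR (- (s ^+ 2 * k * n%:R)))%:E)%E.
  exact: row_deviation.
have PF j : (P (F j) <= (2 * expR (- (s ^+ 2 * k * m%:R)))%:E)%E.
  apply: row_deviation => //.
  - exact: random_tr.
  - by move=> o; exact: entries_in_tr.
  - exact: entries_in_tr.
  - by move=> i j'; under eq_integral do rewrite mxE; rewrite ED mxE.
have mdev p q (G : T -> 'M[R]_(p, q)) (H : 'M[R]_(p, q)) (u : 'rV[R]_q) i :
      random_mx G ->
    measurable [set o | s * (u *m H^T) 0 i <= `|(u *m (G o - H)^T) 0 i|].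
  move=> mG.
  have devE o : (u *m (G o - H)^T) 0 i = \sum_j (G o i j - H i j) * u 0 j.
    by rewrite mul_trE; apply: eq_bigr => j _; rewrite !mxE.
  rewrite (_ : [set o | _] =
      (fun o => `|\sum_j (G o i j - H i j) * u 0 j|) @^-1` `[s * (u *m H^T) 0 i, +oo[).
    rewrite -[X in measurable X]setTI; apply: measurableT_comp => //.
    apply: measurable_sum => j; apply: measurable_funM => //.
    exact: measurable_funB.
  by apply/seteqP; split => o /=; rewrite in_itv/= andbT devE.
have mE i : measurable (E i) by exact: mdev.
have mF j : measurable (F j) by apply: mdev; exact: random_tr.
have [N0 [mN0 PN0 sN0]] : {ae P, forall o, forall ij : 'I_m * 'I_n, a <= B o ij.1 ij.2 <= b}.
  by apply: filter_forall => -[i j]; exact: Bab.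
have sub : ~` S `<=` N0 `|` (\big[setU/set0]_i E i `|` \big[setU/set0]_j F j).
  apply: subsetCl => o /not_orP[oN0 /not_orP[oE oF]].
  have oab : entries_in a b (B o).
    have : ~ ~ (forall ij : 'I_m * 'I_n, a <= B o ij.1 ij.2 <= b).
      by move=> h; apply: oN0; apply: sN0.
    by move=> /contrapT h i j; exact: (h (i, j)).
  have DB : D o = B o by apply/matrixP => i j; rewrite mxE clip_id.
  rewrite /S /=; apply: (sinkhorn_stable m0 n0 r0 c0 rc a0 ab Aab oab x0 y0 xyA (ltW s0)).
  - move=> i; rewrite leNgt; apply/negP => h; apply: oE.
    by rewrite (bigD1 i)//=; left; rewrite /E /= DB ltW.
  - move=> j; rewrite leNgt; apply/negP => h; apply: oF.
    by rewrite (bigD1 j)//=; left; rewrite /F /= DB ltW.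
have mUE : measurable (\big[setU/set0]_i E i) by exact: bigsetU_measurable.
have mUF : measurable (\big[setU/set0]_j F j) by exact: bigsetU_measurable.
apply: (@le_trans _ _ (P (N0 `|` (\big[setU/set0]_i E i `|` \big[setU/set0]_j F j)))).
  apply: le_measure; rewrite ?inE//; first exact: measurableC.
  by apply: measurableU => //; exact: measurableU.
apply: le_trans (measureU2 _ _ _) _ => //; first exact: measurableU.
rewrite [X in (X + _ <= _)%E](_ : _ = 0%E)// add0e; apply: le_trans (measureU2 _ _ _) _ => //.
rewrite EFinD; apply: leeD.
  by have := probability_bigU_le mE PE; rewrite card_ord.
by have := probability_bigU_le mF PF; rewrite card_ord.
Qed.

End Probability.

(** With this s, s ^ 2 k = 2 ln (max) / min, so each exponential is at most max ^ -2; with at most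
    max rows and max columns the total is at most 4 / max. The condition n > 1 makes the logarithm
    positive. *)
Lemma tail_bound (R : realType) (m n : nat) (k : R) : (0 < m)%N -> (1 < n)%N -> 0 < k ->
  let mx := maxn m n in
  let s := Num.sqrt (2 / k) * Num.sqrt (ln mx%:R / (minn m n)%:R) in
  0 < s /\
  m%:R * (2 * expR (- (s ^+ 2 * k * n%:R))) +
  n%:R * (2 * expR (- (s ^+ 2 * k * m%:R))) <= 8 * harmonic n :> R.
Proof.
move=> m0 n1 k0 mx s.
have n0 : (0 < n)%N by exact: ltnW.
have mn0 : 0 < (minn m n)%:R :> R by rewrite ltr0n leq_min m0.
have mx1 : (1 < mx)%N by rewrite leq_max n1 orbT.
have L0 : 0 < ln mx%:R :> R by rewrite ln_gt0// ltr1n.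
have mxR : 0 < mx%:R :> R by rewrite ltr0n ltnW.
have s0 : 0 < s by rewrite mulr_gt0// sqrtr_gt0 divr_gt0.
split=> //.
have sk : s ^+ 2 * k = 2 * (ln mx%:R / (minn m n)%:R).
  rewrite exprMn !sqr_sqrtr ?divr_ge0// ?ltW//.
  by field; rewrite !gt_eqF.
have e2 (p : nat) : (minn m n <= p)%N -> expR (- (s ^+ 2 * k * p%:R)) <= mx%:R ^- 2.
  move=> mp; rewrite (_ : mx%:R ^- 2 = expR (- (2 * ln mx%:R))).
    rewrite ler_expR lerN2 sk -!mulrA ler_pM2l// ler_peMr ?(ltW L0)//.
    by rewrite ler_pdivlMl// mulr1 ler_nat.
  by rewrite expRN expRM_natl lnK// posrE.
apply: (@le_trans _ _ (mx%:R * (2 * mx%:R ^- 2) + mx%:R * (2 * mx%:R ^- 2))).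
  apply: lerD; apply: ler_pM; rewrite ?mulr_ge0 ?expR_ge0 ?ler_nat ?leq_maxl ?leq_maxr//;
    by rewrite ler_pM2l// e2// ?geq_minr// geq_minl.
rewrite (_ : _ + _ = 4 / mx%:R); last by field; rewrite gt_eqF.
apply: (@le_trans _ _ (4 / n%:R)).
  by rewrite ler_pM2l// lef_pV2 ?posrE ?ltr0n// ?ler_nat ?leq_maxr// ltnW.
(* [harmonic n] is 1 / (n + 1), hence the passage from 4 to 8. *)
rewrite /harmonic /= ler_pdivrMr ?ltr0n// mulrAC ler_pdivlMr//.
rewrite -!natrM ler_nat; lia.
Qed.

Theorem corollary5 (R : realType) (N0 : nat) (M : nat -> nat)
    (d : nat -> measure_display) (T : forall N, measurableType (d N))
    (P : forall N, probability (T N) R)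
    (r : forall N, 'rV[R]_(M N)) (c : forall N, 'rV[R]_N)
    (At : forall N, T N -> 'M[R]_(M N, N))
    (A : forall N, 'M[R]_(M N, N))
    (x : forall N, 'rV[R]_(M N)) (y : forall N, 'rV[R]_N)
    (a b C : R) :
  (0 < N0)%N ->
  (forall N, (N0 <= N)%N -> (0 < M N)%N) ->
  M @ \oo --> \oo ->
  (forall N, (N0 <= N)%N ->
     [/\ positive_mx (r N), positive_mx (c N) & norm1 (r N) = norm1 (c N)]) ->
  (forall N, (N0 <= N)%N ->
     random_mx (At N) /\ forall w, positive_mx (At N w)) ->
  (forall N, (N0 <= N)%N ->
     forall i j, (A N i j)%:E = ('E_(P N)[fun w => At N w i j])%E) ->
  (forall N, (N0 <= N)%N ->
     [/\ positive_mx (x N), positive_mx (y N), norm1 (x N) = norm1 (y N) &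
         scales (x N) (y N) (A N) (r N) (c N)]) ->
  0 < a -> a <= b ->
  (forall N, (N0 <= N)%N ->
     forall i j, {ae P N, forall w, a <= At N w i j <= b}) ->
  (forall N, (N0 <= N)%N ->
     forall i, mutually_independent (P N) (fun j w => At N w i j)) ->
  (forall N, (N0 <= N)%N ->
     forall j, mutually_independent (P N) (fun i w => At N w i j)) ->
  (forall N, (N0 <= N)%N ->
     max_entry (r N) / min_entry (r N) <= C /\
     max_entry (c N) / min_entry (c N) <= C) ->
  exists (xt : forall N, T N -> 'rV[R]_(M N)) (yt : forall N, T N -> 'rV[R]_N),
    (forall N, (N0 <= N)%N ->
       [/\ random_mx (xt N), random_mx (yt N) &
           forall w, [/\ positive_mx (xt N w), positive_mx (yt N w) &
             scales (xt N w) (yt N w) (At N w) (r N) (c N)]]) /\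
    bigO_whp P
      (fun N w => scaling_error (x N) (y N) (xt N w) (yt N w))
      (fun N => Num.sqrt (ln (maxn (M N) N)%:R / (minn (M N) N)%:R)).
Proof.
move=> N00 M0 Moo rc0 At0 AE xy0 a0 ab Aab indr indc ratio.
have b0 := lt_le_trans a0 ab.
(* The iteration starts at the scaling vector of the mean matrix, so the distance it travels is the
   error to be bounded. *)
pose yt N (w : T N) : 'rV[R]_N := sinkhorn_lim (At N w) (r N) (c N) (y N).
pose xt N (w : T N) : 'rV[R]_(M N) := row_fit (At N w) (r N) (yt N w).
have n0 N : (N0 <= N)%N -> (0 < N)%N by exact: leq_trans.
have rc N : (N0 <= N)%N -> \sum_i r N 0 i = \sum_j c N 0 j.
  move=> hN; have [r0 c0] := rc0 N hN; rewrite /norm1.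
  under eq_bigr do rewrite gtr0_norm//.
  by under [in RHS]eq_bigr do rewrite gtr0_norm//.
exists xt, yt; split.
  move=> N hN; have [r0 c0 _] := rc0 N hN; have [mA A0] := At0 N hN.
  have [_ y0 _ _] := xy0 N hN.
  have yt0 w : positive_mx (yt N w).
    by have [] := sinkhorn_lim_correct (M0 N hN) (n0 N hN) (A0 w) r0 c0 y0 (rc N hN).
  have myt : random_mx (yt N).
    exact: (random_sinkhorn_lim (M0 N hN) (n0 N hN) A0 mA r0 c0 y0 (rc N hN)).
  split=> //; first exact: random_row_fit.
  move=> w; split=> //; first by apply: positive_row_fit => //; exact: n0.
  by have [] := sinkhorn_lim_correct (M0 N hN) (n0 N hN) (A0 w) r0 c0 y0 (rc N hN).
(* An entry of [c N0], which exists since N0 > 0, is at most C times itself. *)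
have C0 : 0 < C.
  have [_ c0 _] := rc0 N0 (leqnn _); have [_ cC] := ratio N0 (leqnn _).
  have := entry_ratio N00 c0 cC (Ordinal N00) (Ordinal N00).
  rewrite -ler_pdivrMr ?c0// divff ?gt_eqF ?c0//.
  exact: lt_le_trans.
pose k := a ^+ 2 / (8 * b ^+ 2 * (C * (b / a))).
have k0 : 0 < k by rewrite !(divr_gt0, mulr_gt0, exprn_gt0).
(* The factor sqrt (2 / k) is the one in the deviation level s of [tail_bound]. *)
exists (stability_const a b * Num.sqrt (2 / k)).
apply: (@squeeze_cvge _ _ _ _ (fun N => (1 - 8 * harmonic N)%:E) _ (cst 1%E)).
- near=> N.
  have hN : (N0 <= N)%N by near: N; exists N0.
  have N1 : (1 < N)%N by near: N; exists 2%N.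
  have [r0 c0 _] := rc0 N hN; have [mA A0] := At0 N hN.
  have [x0 y0 _ xyA] := xy0 N hN; have [rC cC] := ratio N hN.
  have [s0 tail] := tail_bound (M0 N hN) N1 k0.
  have [mS PS] := scaling_error_tail (M0 N hN) (n0 N hN) a0 ab C0 s0 r0 c0
    (rc N hN) mA A0 (AE N hN) x0 y0 xyA (Aab N hN) (indr N hN) (indc N hN)
    (entry_ratio (M0 N hN) r0 rC) (entry_ratio (n0 N hN) c0 cC).
  rewrite /= -(mulrA (stability_const a b)) probability_le1 ?andbT//.
  have := le_trans PS _; rewrite -/k => /(_ (8 * harmonic N)%:E).
  rewrite lee_fin => /(_ tail); rewrite probability_setC//.
  rewrite -(@fineK _ (P N _)) ?fin_num_measure//.
  by rewrite -EFinB !lee_fin lerBlDr -lerBlDl.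
- apply: cvg_EFin; first exact: nearW.
  rewrite -[X in _ --> X]subr0 -[X in _ - X](mulr0 8).
  apply: cvgB; first exact: cvg_cst.
  by apply: cvgM; [exact: cvg_cst|exact: cvg_harmonic].
- exact: cvg_cst.
Unshelve. all: by end_near. Qed.
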